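(* Assume that for each $i=1,2$ there exist $\varepsilon_i,\eta_i>0$ and $\rho_i,\theta_i>0$ with $\rho_i\le c_i\theta_i$ such that $$f_i(r,w_1,w_2,z_1,z_2)\le \frac{\mu(\mathcal L_i)-\varepsilon_i}{\sup_{t\in[0,1]}p(t)}\,w_i\quad\text{for all }(r,w_1,w_2,z_1,z_2)\in\Omega^{\rho_1,\rho_2}$$ and $$f_i(r,w_1,w_2,z_1,z_2)\ge \frac{\mu(\overline{\mathcal L}_i)+\eta_i}{\inf_{t\in[a_i,b_i]}p(t)}\,w_i\quad\text{for all }(r,w_1,w_2,z_1,z_2)\in D_i^{\theta_1,\theta_2},$$ where $$\Omega^{\rho_1,\rho_2}=[R_0,R_1]\times[0,\rho_1]\times[0,\rho_2]\times[0,+\infty)^2,$$ $$D_1^{\theta_1,\theta_2}=[\min\{r(a_1),r(b_1)\},\max\{r(a_1),r(b_1)\}]\times[c_1\theta_1,+\infty)\times[0,+\infty)^3,$$ $$D_2^{\theta_1,\theta_2}=[\min\{r(a_2),r(b_2)\},\max\{r(a_2),r(b_2)\}]\times[0,+\infty)\times[c_2\theta_2,+\infty)\times[0,+\infty)^2.$$ Then the elliptic system $$\begin{cases}-\Delta u=f_1(|x|,u,v,|\nabla u|,|\nabla v|)\ \text{in }\Omega,\\ -\Delta v=f_2(|x|,u,v,|\nabla u|,|\nabla v|)\ \text{in }\Omega,\\ u=0\ \text{on }\partial\Omega,\\ v=0\ \text{on }|x|=R_0,\quad \frac{\partial v}{\partial r}=0\ \text{on }|x|=R_1\end{cases}$$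 has at least one positive radial solution; that is, there is $(u,v)\in\mathcal K$ with $\|(u,v)\|>0$ solving the associated system of ODEs, in the sense that $(u,v)=\mathcal T(u,v)$.
   Context: Domain and nonlinearities. $n\ge 2$, $0<R_0<R_1<+\infty$, $\Omega=\{x\in\mathbb R^n:R_0<|x|<R_1\}$, and $f_1,f_2:[R_0,R_1]\times[0,+\infty)^4\to[0,+\infty)$ are continuous; $\partial/\partial r$ is the radial derivative. Change of variables. For $t\in[0,1]$: if $n=2$, $r(t)=R_0^{1-t}R_1^{t}$ and $p(t)=r(t)^2\log^2(R_1/R_0)$; if $n\ge3$, $r(t)=\left(\frac{A}{B-t}\right)^{1/(n-2)}$ with $A=\frac{(R_0R_1)^{n-2}}{R_1^{n-2}-R_0^{n-2}}$, $B=\frac{R_1^{n-2}}{R_1^{n-2}-R_0^{n-2}}$, and $p(t)=\left(\frac{R_0R_1(R_1^{n-2}-R_0^{n-2})}{n-2}\right)^2\left(R_1^{n-2}-(R_1^{n-2}-R_0^{n-2})t\right)^{-2(n-1)/(n-2)}$. Put $g_i(t,w_1,w_2,z_1,z_2)=p(t)f_i\left(r(t),w_1,w_2,\frac{z_1}{|r'(t)|},\frac{z_2}{|r'(t)|}\right)$. The associated system of ODEs on $[0,1]$ is $-u''=g_1(t,u,v,|u'|,|v'|)$, $-v''=g_2(t,u,v,|u'|,|v'|)$, $u(0)=u(1)=v(0)=v'(1)=0$. A radial solution of the elliptic system means a solution of this ODE system, and solutions of the ODE system are sought as fixed points of the operator $\mathcal T$ below. Spaces and cone. $\omega_1(t)=t(1-t)$,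 $\omega_2(t)=t$. $C^1_{\omega_i}[0,1]$ is the Banach space of $w\in C[0,1]$ continuously differentiable on $]0,1[$ with $\|w'\|_{\omega_i}:=\sup_{t\in]0,1[}\omega_i(t)|w'(t)|<\infty$, with norm $\|w\|=\max\{\|w\|_\infty,\|w'\|_{\omega_i}\}$; on the product, $\|(u,v)\|=\max\{\|u\|,\|v\|\}$. Fix $[a_1,b_1]\subset(0,1)$ and $[a_2,b_2]\subset(0,1]$ with $a_i<b_i$, $c_1=\min\{a_1,1-b_1\}$, $c_2=a_2$. Let $\mathcal K_{\omega_i}=\{w\in C^1_{\omega_i}[0,1]:w\ge0,\ \min_{[a_i,b_i]}w\ge c_i\|w\|_\infty,\ \|w\|_\infty\ge\|w'\|_{\omega_i}\}$ and $\mathcal K=\mathcal K_{\omega_1}\times\mathcal K_{\omega_2}$. Operators. $k_1(t,s)=s(1-t)$ for $s\le t$, $k_1(t,s)=t(1-s)$ for $t\le s$; $k_2(t,s)=\min\{s,t\}$. $\mathcal T=(\mathcal T_1,\mathcal T_2)$ with $\mathcal T_i(u,v)(t)=\int_0^1k_i(t,s)g_i(s,u(s),v(s),|u'(s)|,|v'(s)|)\,ds$. Standing assumption: $\mathcal T$ is a well-defined compact map from $\mathcal K$ into $\mathcal K$ (continuous, mapping bounded sets to relatively compact sets). $\mathcal L_i:C^1_{\omega_i}[0,1]\to C^1_{\omega_i}[0,1]$, $\mathcal L_iw(t)=\int_0^1k_i(t,s)w(s)\,ds$; $\overline{\mathcal L}_i:C^1_{\omega_i}[a_i,b_i]\to C^1_{\omega_i}[a_i,b_i]$,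 $\overline{\mathcal L}_iw(t)=\int_{a_i}^{b_i}k_i(t,s)w(s)\,ds$ for $t\in[a_i,b_i]$, where $C^1_{\omega_i}[a_i,b_i]$ is the Banach space of $w\in C[a_i,b_i]$ continuously differentiable on $]a_i,b_i[$ with $\sup_{t\in]a_i,b_i[}\omega_i(t)|w'(t)|<\infty$, with norm $\max\{\max_{t\in[a_i,b_i]}|w(t)|,\ \sup_{t\in]a_i,b_i[}\omega_i(t)|w'(t)|\}$. For a bounded linear operator $L$, $r(L)=\lim_{m\to\infty}\|L^m\|^{1/m}$ is its spectral radius and $\mu(L)=1/r(L)$ its principal characteristic value (the spectral radii here are positive). *)

(* Defs.v *)
From HB Require Import structures.
From mathcomp Require Import ring.
From mathcomp Require Import all_boot all_order all_algebra.
From mathcomp Require Import all_classical all_reals all_analysis.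

Set Implicit Arguments.
Unset Strict Implicit.
Unset Printing Implicit Defensive.

Import Order.TTheory GRing.Theory Num.Theory.
Import numFieldNormedType.Exports.

Local Open Scope classical_set_scope.
Local Open Scope ring_scope.

Section WeightedC1.
Context {R : realType}.
Variables (om : R -> R) (a b : R).
Implicit Types w : R -> R.

Definition sup_norm w : R := sup [set `|w t| | t in `[a, b]].

(* The weights used below are nonnegative on `]a, b[, so that this is the
   supremum of [om t * `|w' t|]. *)
Definition der_norm w : R := sup [set `|om t * derive1 w t| | t in `]a, b[].

(* An element of the space of functions on [a, b] is represented by its
   extension by 0 to the real line. This makes Leibniz equality the equality
   on [a, b], and it does not affect derivatives in ]a, b[. *)
Definition c1w_spec w : Prop :=
  [/\ {within `[a, b], continuous w},
      {in `]a, b[, forall t, derivable w t 1},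
      {in `]a, b[, continuous (derive1 w)},
      has_ubound [set `|om t * derive1 w t| | t in `]a, b[] &
      forall t, t \notin `[a, b] -> w t = 0].

Definition c1w_pred : {pred R -> R} := mem [set w | c1w_spec w].

Record c1w := MkC1w { c1w_fun :> R -> R; _ : c1w_fun \in c1w_pred }.

HB.instance Definition _ := [isSub for c1w_fun].
HB.instance Definition _ := [Choice of c1w by <:].

Lemma c1wP (w : c1w) : c1w_spec w.
Proof. by case: w => w /= /set_mem. Qed.

Lemma c1w_submod_closed : submod_closed c1w_pred.
Proof.
split.
  rewrite inE; split => /=.
  - by move=> x; exact: cvg_cst.
  - by move=> t _; exact: derivable_cst.
  - have -> : derive1 (0 : R -> R) = cst 0.
      by apply/funext => t; exact: derive1_cst.
    by move=> t _; exact: cvg_cst.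
  - exists 0 => _ [t _ <-]; have -> : derive1 (0 : R -> R) t = 0 by exact: derive1_cst.
    by rewrite mulr0 normr0.
  - by [].
move=> k f g; rewrite !inE => -[cf df df' [Mf bf] f0] [cg dg dg' [Mg bg] g0].
have dE t : t \in `]a, b[ -> derive1 (k *: f + g) t = k * derive1 f t + derive1 g t.
  move=> tab; rewrite !derive1E deriveD//; last exact: dg.
    by rewrite deriveZ//; exact: df.
  by apply: derivableZ; exact: df.
split => /=.
- move=> x; apply: cvgD; last exact: cg.
  by apply: cvgZr; exact: cf.
- move=> t tab; apply: derivableD; last exact: dg.
  by apply: derivableZ; exact: df.
- move=> t tab; rewrite /continuous_at dE//.
  have cD : (fun s => k * derive1 f s + derive1 g s) @ t -->
      k * derive1 f t + derive1 g t.
    by apply: cvgD; [apply: cvgM; [exact: cvg_cst|exact: df']|exact: dg'].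
  apply: cvg_trans cD; apply: near_eq_cvg; have := near_in_itvoo tab.
  by apply: filterS => s sab; rewrite dE.
- exists (`|k| * Mf + Mg) => _ [t tab <-]; rewrite dE// mulrDr.
  rewrite (le_trans (ler_normD _ _))// lerD//; last by apply: bg; exists t.
  by rewrite mulrCA normrM ler_wpM2l//; apply: bf; exists t.
- by move=> t tab; rewrite !fctE/= f0// g0// scaler0 addr0.
Qed.

HB.instance Definition _ :=
  GRing.isSubmodClosed.Build _ _ c1w_pred c1w_submod_closed.
HB.instance Definition _ := [SubChoice_isSubLmodule of c1w by <:].

Definition c1w_norm (w : c1w) : R := Num.max (sup_norm w) (der_norm w).

Let seminormD (D : set R) (f g h : R -> R) :
  has_ubound [set `|f t| | t in D] -> has_ubound [set `|g t| | t in D] ->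
  (forall t, D t -> h t = f t + g t) ->
  sup [set `|h t| | t in D] <= sup [set `|f t| | t in D] + sup [set `|g t| | t in D].
Proof.
move=> bf bg hE; have [->|/set0P[x Dx]] := eqVneq D set0.
  by rewrite !image_set0 sup0 addr0.
apply: ge_sup; first by exists `|h x|, x.
move=> _ [t Dt <-]; rewrite hE// (le_trans (ler_normD _ _))//.
by rewrite lerD//; apply: ub_le_sup => //; exists t.
Qed.

Let seminormZ (D : set R) (k : R) (f h : R -> R) :
  has_ubound [set `|f t| | t in D] ->
  (forall t, D t -> h t = k * f t) ->
  sup [set `|h t| | t in D] = `|k| * sup [set `|f t| | t in D].
Proof.
move=> bf hE; have [->|/set0P[x Dx]] := eqVneq D set0.
  by rewrite !image_set0 sup0 mulr0.
apply/eqP; rewrite eq_le; apply/andP; split.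
  apply: ge_sup; first by exists `|h x|, x.
  move=> _ [t Dt <-]; rewrite hE// normrM ler_wpM2l//.
  by apply: ub_le_sup => //; exists t.
have [k0|k0] := eqVneq k 0.
  rewrite k0 normr0 mul0r; apply: (le_trans (normr_ge0 (h x))).
  apply: ub_le_sup; last by exists x.
  by exists 0 => _ [t Dt <-]; rewrite hE// k0 mul0r normr0.
rewrite -ler_pdivlMl ?normr_gt0//; apply: ge_sup; first by exists `|f x|, x.
move=> _ [t Dt <-]; rewrite ler_pdivlMl ?normr_gt0// -normrM -hE//.
apply: ub_le_sup; last by exists t.
case: bf => M bM; exists (`|k| * M) => _ [s Ds <-].
by rewrite hE// normrM ler_wpM2l//; apply: bM; exists s.
Qed.

Lemma c1w_has_ubound (w : c1w) : has_ubound [set `|w t| | t in `[a, b]].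
Proof.
have [cw _ _ _ _] := c1wP w.
have : compact ((w : R -> R) @` `[a, b]).
  by apply: continuous_compact => //; exact: segment_compact.
move=> /compact_bounded[M [Mr bM]]; exists (M + 1) => _ [t tab <-].
by apply: (bM (M + 1)); [rewrite ltrDl|exists t].
Qed.

Lemma c1w_normD (v w : c1w) : c1w_norm (v + w) <= c1w_norm v + c1w_norm w.
Proof.
have [_ dv _ bv _] := c1wP v; have [_ dw _ bw _] := c1wP w.
rewrite ge_max; apply/andP; split.
  apply: (@le_trans _ _ (sup_norm v + sup_norm w)); last first.
    by rewrite lerD// le_max lexx.
  by apply: seminormD => //; exact: c1w_has_ubound.
apply: (@le_trans _ _ (der_norm v + der_norm w)); last first.
  by rewrite lerD// le_max lexx orbT.
apply: (@seminormD _ (fun t => om t * derive1 v t)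
  (fun t => om t * derive1 w t)) => // t tab.
rewrite -mulrDr !derive1E; congr (_ * _).
by rewrite -deriveD//; [exact: dv|exact: dw].
Qed.

Lemma c1w_normZ (k : R) (w : c1w) : c1w_norm (k *: w) = `|k| * c1w_norm w.
Proof.
have [_ dw _ bw _] := c1wP w; rewrite maxr_pMr//; congr Num.max.
  by apply: seminormZ => //; exact: c1w_has_ubound.
apply: (@seminormZ _ _ (fun t => om t * derive1 w t)) => // t tab.
rewrite mulrCA !derive1E; congr (_ * _).
by rewrite -[RHS]deriveZ//; exact: dw.
Qed.

Lemma c1w_norm_eq0 (w : c1w) : c1w_norm w = 0 -> w = 0.
Proof.
move=> w0; apply/val_inj/funext => t /=.
have [tab|tab] := boolP (t \in `[a, b]); last by have [_ _ _ _ ->] := c1wP w.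
apply/eqP; rewrite -normr_le0 -w0 le_max; apply/orP; left.
by apply: (ub_le_sup (c1w_has_ubound w)); exists t.
Qed.

HB.instance Definition _ :=
  Lmodule_isNormed.Build R c1w c1w_normD c1w_normZ c1w_norm_eq0.

End WeightedC1.
Arguments c1w {R} om a b.

Section Green.
Context {R : realType}.
Implicit Types (t s : R).

Definition omega1 t : R := t * (1 - t).
Definition omega2 t : R := t.

Definition k1 t s : R := if s <= t then s * (1 - t) else t * (1 - s).
Definition k2 t s : R := Num.min s t.

Definition integral_op (k : R -> R -> R) (a b : R) (w : R -> R) : R -> R :=
  (fun t => \int[lebesgue_measure]_(s in `[a, b]) (k t s * w s)) \_ `[a, b].

(* Both kernels have the form [s * q t] for [s <= t] and [t * q s] otherwise,
   with [q x = 1 - d * x] for [d = 1] and [d = 0] respectively. *)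
Let green_c1w (d : R) (k : R -> R -> R) (om : R -> R) (a b : R)
    (w : R -> R) :
  (forall t s, s <= t -> k t s = s * (1 - d * t)) ->
  (forall t s, t <= s -> k t s = t * (1 - d * s)) ->
  continuous om -> {within `[a, b], continuous w} ->
  integral_op k a b w \in c1w_pred om a b.
Proof.
move=> kl kr com cw.
pose mu := @lebesgue_measure R.
have outE t : t \notin `[a, b] -> integral_op k a b w t = 0.
  by move=> tab; rewrite /integral_op patchE ifF//; apply/negbTE; rewrite mem_setE.
have [ab|ba] := ltP a b; last first.
  have E0 : `]a, b[%classic = set0 :> set R.
    by rewrite set_itv_ge// bnd_simp -leNgt.
  have no t : t \in `]a, b[ -> False.
    by move=> tab; have : `]a, b[%classic t by []; rewrite E0.
  rewrite inE; split => /=.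
  - move: ba; rewrite le_eqVlt => /predU1P[->|ba].
      by rewrite set_itv1; exact: continuous_subspace1.
    by rewrite set_itv_ge ?bnd_simp -?ltNge//; exact: continuous_subspace0.
  - by move=> t /no.
  - by move=> t /no.
  - by exists 0 => _ [t tab <-]; case: (no t tab).
  - exact: outE.
pose u t := t * w t; pose v t := (1 - d * t) * w t.
have cid (D : set R) : {within D, continuous (id : R -> R)}.
  by apply: continuous_subspaceT => x; exact: cvg_id.
have caff (D : set R) : {within D, continuous (fun t : R => 1 - d * t)}.
  apply: continuous_subspaceT => x.
  by apply: cvgB; [exact: cvg_cst|apply: cvgM; [exact: cvg_cst|exact: cvg_id]].
have cu : {within `[a, b], continuous u}.
  by move=> x; apply: cvgM; [exact: cid|exact: cw].
have cv : {within `[a, b], continuous v}.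
  by move=> x; apply: cvgM; [exact: caff|exact: cw].
have integ (f : R -> R) : {within `[a, b], continuous f} ->
    mu.-integrable `[a, b] (EFin \o f).
  by move=> cf; apply: continuous_compact_integrable => //; exact: segment_compact.
have iu := integ _ cu; have iv := integ _ cv.
pose U t := \int[mu]_(s in `[a, t]) u s.
pose V t := \int[mu]_(s in `[a, t]) v s.
pose G t := (1 - d * t) * U t + t * (V b - V t).
pose H t := - d * U t + (V b - V t).
have cU : {within `[a, b], continuous U}.
  by apply: parameterized_integral_continuous => //; exact: ltW.
have cV : {within `[a, b], continuous V}.
  by apply: parameterized_integral_continuous => //; exact: ltW.
have cBV : {within `[a, b], continuous (fun t => V b - V t)}.
  by move=> x; apply: cvgB; [exact: cvg_cst|exact: cV].
have cG : {within `[a, b], continuous G}.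
  move=> x; apply: cvgD; first by apply: cvgM; [exact: caff|exact: cU].
  by apply: cvgM; [exact: cid|exact: cBV].
have cH : {within `[a, b], continuous H}.
  by move=> x; apply: cvgD; [apply: cvgM; [exact: cvg_cst|exact: cU]|exact: cBV].
have GE t : t \in `[a, b] -> integral_op k a b w t = G t.
  move=> tab; rewrite /integral_op patchE ifT ?mem_setE//.
  have [at_ tb] : a <= t /\ t <= b by move: tab; rewrite in_itv => /andP.
  have sl : `[a, t] `<=` `[a, b] by apply: subset_itvl; rewrite bnd_simp.
  have sr : `]t, b] `<=` `[a, b] by apply: subset_itvr; rewrite bnd_simp.
  have abE : `[a, b]%classic = `[a, t] `|` `]t, b].
    by rewrite -itv_bndbnd_setU// bnd_simp.
  have ck : {within `[a, b], continuous (fun s => k t s * w s)}.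
    have kE s : k t s = Num.min s t * (1 - d * Num.max s t).
      by case: (leP s t) => st; [rewrite kl|rewrite kr// ltW].
    have -> : (fun s => k t s * w s) =
        (fun s => Num.min s t * (1 - d * Num.max s t) * w s).
      by apply/funext => s; rewrite kE.
    move=> x; apply: cvgM; last exact: cw.
    apply: cvgM; first by apply: continuous_min; [exact: cid|exact: cvg_cst].
    apply: cvgB; first exact: cvg_cst.
    apply: cvgM; first exact: cvg_cst.
    by apply: continuous_max; [exact: cid|exact: cvg_cst].
  rewrite /G abE Rintegral_setU//; last 2 first.
  - by rewrite -abE; exact: integ.
  - apply/disj_setPS => s /= []; rewrite !in_itv/= => /andP[_ st] /andP[ts _].
    by move: (le_lt_trans st ts); rewrite ltxx.
  congr (_ + _).
    rewrite -RintegralZl//; last exact: integrableS iu.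
    apply: eq_Rintegral => s; rewrite inE/= in_itv/= => /andP[_ st].
    by rewrite kl// /u mulrAC mulrC mulrA.
  rewrite Rintegral_itvB ?bnd_simp//.
  rewrite -RintegralZl//; last exact: integrableS iv.
  apply: eq_Rintegral => s; rewrite inE/= in_itv/= => /andP[/ltW ts _].
  by rewrite kr// /v mulrA.
have nearE t : t \in `]a, b[ -> \forall s \near t, integral_op k a b w s = G s.
  move=> /near_in_itvoo; apply: filterS => s sab; rewrite GE//.
  exact: subset_itv_oo_cc sab.
have dG t : t \in `]a, b[ -> is_derive t 1 G (H t).
  move=> tab; have [at_ tb] : a < t /\ t < b by move: tab; rewrite in_itv => /andP.
  have at_cont (f : R -> R) : {within `[a, b], continuous f} ->
      {for t, continuous f}.
    by move=> /(continuous_within_itvP _ ab)[+ _ _]; apply.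
  have [dU U'] := continuous_FTC1_closed tb iu at_ (at_cont _ cu).
  have [dV V'] := continuous_FTC1_closed tb iv at_ (at_cont _ cv).
  have iU : is_derive t 1 U (u t).
    by apply: DeriveDef; [exact: dU|rewrite -U' derive1E].
  have iV : is_derive t 1 V (v t).
    by apply: DeriveDef; [exact: dV|rewrite -V' derive1E].
  rewrite /G; apply: is_derive_eq.
  rewrite /H /u /v /GRing.scale /=; ring.
have dL t : t \in `]a, b[ -> is_derive t 1 (integral_op k a b w) (H t).
  move=> tab; apply: near_eq_is_derive (dG t tab).
  by apply: filterS (nearE t tab) => s ->.
have d1L t : t \in `]a, b[ -> derive1 (integral_op k a b w) t = H t.
  by move=> tab; rewrite derive1E; have [_ ->] := dL t tab.
rewrite inE; split => /=.
- apply: subspace_eq_continuous cG => t; rewrite inE => tab.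
  by rewrite /from_subspace GE.
- by move=> t /dL[].
- move=> t tab; rewrite /continuous_at d1L//.
  have cHt : H @ t --> H t.
    by move: cH => /(continuous_within_itvP _ ab)[+ _ _]; apply.
  apply: cvg_trans cHt; apply: near_eq_cvg; have := near_in_itvoo tab.
  by apply: filterS => s sab; rewrite d1L.
- have cK : {within `[a, b], continuous (fun t => om t * H t)}.
    move=> x; apply: cvgM; last exact: cH.
    by apply: continuous_subspaceT.
  have : compact ((fun t => om t * H t) @` `[a, b]).
    by apply: continuous_compact => //; exact: segment_compact.
  move=> /compact_bounded[M [Mr bM]]; exists (M + 1) => _ [t tab <-].
  rewrite d1L//; apply: (bM (M + 1)); first by rewrite ltrDl.
  by exists t => //; exact: subset_itv_oo_cc.
- exact: outE.
Qed.

Lemma k1_c1w (a b : R) (w : c1w omega1 a b) :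
  integral_op k1 a b w \in c1w_pred omega1 a b.
Proof.
have [cw _ _ _ _] := c1wP w.
apply: (@green_c1w 1) => //.
- by move=> t s st; rewrite /k1 st mul1r.
- move=> t s; rewrite /k1 le_eqVlt => /predU1P[->|ts].
    by rewrite lexx mul1r.
  by rewrite leNgt ts mul1r.
- move=> x; apply: cvgM; first exact: cvg_id.
  by apply: cvgB; [exact: cvg_cst|exact: cvg_id].
Qed.

Lemma k2_c1w (a b : R) (w : c1w omega2 a b) :
  integral_op k2 a b w \in c1w_pred omega2 a b.
Proof.
have [cw _ _ _ _] := c1wP w.
apply: (@green_c1w 0) => //.
- by move=> t s st; rewrite /k2 mul0r subr0 mulr1 min_l.
- by move=> t s st; rewrite /k2 mul0r subr0 mulr1 min_r.
- by move=> x; exact: cvg_id.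
Qed.

Definition L1 (a b : R) (w : c1w omega1 a b) : c1w omega1 a b :=
  MkC1w (k1_c1w w).

Definition L2 (a b : R) (w : c1w omega2 a b) : c1w omega2 a b :=
  MkC1w (k2_c1w w).

End Green.
Arguments L1 {R} a b w.
Arguments L2 {R} a b w.

Section Operators.
Context {R : realType} {V : normedModType R}.

Definition op_norm (L : V -> V) : R :=
  sup [set `|L x| | x in [set x | `|x| <= 1]].

Definition spectral_radius (L : V -> V) : R :=
  limn (fun m => op_norm (iter m L) `^ m%:R^-1).

Definition char_value (L : V -> V) : R := (spectral_radius L)^-1.

Definition compact_self_map (K : set V) (T : V -> V) : Prop :=
  [/\ T @` K `<=` K, {within K, continuous T} &
      forall B : set V, B `<=` K -> bounded_set B -> precompact (T @` B)].

End Operators.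

Section ChangeOfVariables.
Context {R : realType}.
Variables (n : nat) (R0 R1 : R).

Definition r_of (t : R) : R :=
  if n == 2%N then R0 `^ (1 - t) * R1 `^ t
  else let D := R1 ^+ (n - 2) - R0 ^+ (n - 2) in
       let A := (R0 * R1) ^+ (n - 2) / D in
       let B := R1 ^+ (n - 2) / D in
       (A / (B - t)) `^ (n - 2)%:R^-1.

Definition p_coef (t : R) : R :=
  if n == 2%N then r_of t ^+ 2 * ln (R1 / R0) ^+ 2
  else let D := R1 ^+ (n - 2) - R0 ^+ (n - 2) in
       (R0 * R1 * D / (n - 2)%:R) ^+ 2 *
       (R1 ^+ (n - 2) - D * t) `^ (- (2 * (n - 1)%:R / (n - 2)%:R)).

(* A nonlinearity f(r, w1, w2, z1, z2) is a function of a 5-tuple. *)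
Definition transformed (f : R * R * R * R * R -> R) (t w1 w2 z1 z2 : R) : R :=
  p_coef t *
  f (r_of t, w1, w2, z1 / `|derive1 r_of t|, z2 / `|derive1 r_of t|).

End ChangeOfVariables.

Section Cone.
Context {R : realType}.

Definition cone_component (om : R -> R) (a b c : R) : set (c1w om 0 1) :=
  [set w | [/\ forall t, t \in `[0, 1] -> 0 <= w t,
               inf (w @` `[a, b]) >= c * sup_norm 0 1 w &
               sup_norm 0 1 w >= der_norm om 0 1 w]].

(* The norm of the library on a product is the maximum of the two norms. *)
Definition c1w_pair : normedModType R := (c1w omega1 0 1 * c1w omega2 0 1)%type.

Definition cst1 (a1 b1 : R) : R := Num.min a1 (1 - b1).
Definition cst2 (a2 : R) : R := a2.

Definition cone (a1 b1 a2 b2 : R) : set c1w_pair :=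
  cone_component a1 b1 (cst1 a1 b1) `*` cone_component a2 b2 (cst2 a2).

End Cone.
Arguments c1w_pair : clear implicits.

Section FixedPointOperator.
Context {R : realType}.
Variables (n : nat) (R0 R1 : R) (f1 f2 : R * R * R * R * R -> R).

Definition integrand (k : R -> R -> R) (f : R * R * R * R * R -> R)
    (u v : R -> R) (t s : R) : R :=
  k t s *
  transformed n R0 R1 f s (u s) (v s) `|derive1 u s| `|derive1 v s|.

Definition T_fun (k : R -> R -> R) (f : R * R * R * R * R -> R)
    (u v : R -> R) : R -> R :=
  (fun t => \int[lebesgue_measure]_(s in `[0, 1]) integrand k f u v t s)
  \_ `[0, 1].

(* [insubd 0 f] is f if f is in the space and 0 otherwise; the real-valued
   integral is meaningful for integrable functions only. [T_defined K] says
   that neither default value is used on K. *)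
Definition T_op (x : c1w_pair R) : c1w_pair R :=
  (insubd 0 (T_fun k1 f1 x.1 x.2), insubd 0 (T_fun k2 f2 x.1 x.2)).

Definition T_defined (K : set (c1w_pair R)) : Prop :=
  forall x, K x ->
    [/\ forall t, t \in `[0, 1] ->
          lebesgue_measure.-integrable `[0, 1]
            (EFin \o integrand k1 f1 x.1 x.2 t),
        forall t, t \in `[0, 1] ->
          lebesgue_measure.-integrable `[0, 1]
            (EFin \o integrand k2 f2 x.1 x.2 t),
        T_fun k1 f1 x.1 x.2 \in c1w_pred omega1 0 1 &
        T_fun k2 f2 x.1 x.2 \in c1w_pred omega2 0 1].

End FixedPointOperator.

Section Regions.
Context {R : realType}.
Variables (n : nat) (R0 R1 : R).

Definition f_domain : set (R * R * R * R * R) :=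
  [set x | let: (r, w1, w2, z1, z2) := x in
    [/\ R0 <= r <= R1, 0 <= w1, 0 <= w2, 0 <= z1 & 0 <= z2]].

Definition Omega_region (rho1 rho2 : R) : set (R * R * R * R * R) :=
  [set x | let: (r, w1, w2, z1, z2) := x in
    [/\ R0 <= r <= R1, 0 <= w1 <= rho1, 0 <= w2 <= rho2, 0 <= z1 & 0 <= z2]].

Definition between_r (a b r : R) : bool :=
  Num.min (r_of n R0 R1 a) (r_of n R0 R1 b) <= r <=
  Num.max (r_of n R0 R1 a) (r_of n R0 R1 b).

Definition D1_region (a1 b1 theta1 : R) : set (R * R * R * R * R) :=
  [set x | let: (r, w1, w2, z1, z2) := x in
    [/\ between_r a1 b1 r, cst1 a1 b1 * theta1 <= w1,
        0 <= w2, 0 <= z1 & 0 <= z2]].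

Definition D2_region (a2 b2 theta2 : R) : set (R * R * R * R * R) :=
  [set x | let: (r, w1, w2, z1, z2) := x in
    [/\ between_r a2 b2 r, 0 <= w1, cst2 a2 * theta2 <= w2,
        0 <= z1 & 0 <= z2]].

End Regions.

(* Main.v *)
Require Import Defs.
From mathcomp Require Import all_boot all_order all_algebra.

(* The cone K of the statement is not convex, because of the condition
   |w|_oo >= |w'|_omega, but T maps it into the smaller convex cone of pairs of
   functions satisfying the chord inequalities of concave functions with the
   boundary conditions at hand. On that cone put
   N (u, v) = max (|u|_oo / theta1) (|v|_oo / theta2). The bound above by
   mu (L_i) excludes x = s T x with 0 <= s <= 1 when N x > 0 is small, since
   u <= lam L u forces u <= lam^m |L^m| |u| -> 0; the bound below by mu (Lbar_i)
   excludes x = T x + m e with m >= 0 when N x >= 1, since v >= lam Lbar v and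
   v >= kap > 0 on [a_i, b_i] force v >= kap lam^m Lbar^m 1, which is unbounded.
   Both use only that the limit defining the spectral radius exists (Fekete).

   For such an expansive map, let F be T damped to 0 near the origin, pushed
   towards e for large N, and perturbed by a small multiple of e so that N (F x)
   stays away from 0. The radial flip x |-> (N x)^2 / N (F x)^2 . F x is then a
   compact self-map of the ball N <= 2, to which Schauder's theorem applies; its
   fixed point is a fixed point of F, and letting the perturbation tend to 0
   gives one of T.

   Schauder's theorem is reduced to Brouwer's theorem on a simplex, and the
   latter to Scarf's combinatorial lemma on dominant sets, which replaces
   triangulations by a family of linear orders on the points of a grid. *)

Set Implicit Arguments.
Unset Strict Implicit.
Unset Printing Implicit Defensive.

(** * Scarf's lemma *)

Section DominantSets.
Variables (I Y : finType) (r : I -> Y -> nat).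
Hypothesis r_inj : forall i, injective (r i).
Implicit Types (s t : {set Y}) (y z : Y) (i j k : I).

(** Dominant sets stand in for the simplices of a triangulation; those with as many points as there
    are orders are the cells. *)
Definition dominant s :=
  [forall y, exists i, [forall x in s, r i y <= r i x]].

Lemma dominantP s :
  reflect (forall y, exists i, forall x, x \in s -> r i y <= r i x) (dominant s).
Proof.
apply: (iffP forallP) => [h y|h y].
  by have /existsP[i /forall_inP] := h y; exists i.
by apply/existsP; have [i hi] := h y; exists i; apply/forall_inP.
Qed.

Lemma dominantS s t : s \subset t -> dominant t -> dominant s.
Proof.
move=> /subsetP st /dominantP h; apply/dominantP => y.
by have [i hi] := h y; exists i => x /st; exact: hi.
Qed.

(** By dominance the minima [m k] of [t] cover [t]. There is one order more than there are points,
    so exactly one pair [i], [j] of orders shares its minimum. A new point has to take over the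
    minimum for [i] or for [j], and dominance then forces it to be the highest point for that order
    among those above the other minima. *)
Lemma card_extensions2 t : dominant t -> t != set0 -> #|t|.+1 = #|I| ->
  (forall i, exists y, forall k, k != i -> exists2 x, x \in t & r k x < r k y) ->
  #|[set y | (y \notin t) && dominant (y |: t)]| = 2.
Proof.
move=> /dominantP dt /set0Pn[x0 x0t] ct above.
pose m k := [arg min_(x < x0 in t) r k x].
have mt k : m k \in t by rewrite /m; case: arg_minnP.
have ml k x : x \in t -> r k (m k) <= r k x.
  by rewrite /m; case: arg_minnP => // z _ h /h.
have mE k x : x \in t -> r k x <= r k (m k) -> x = m k.
  by move=> xt h; apply: (@r_inj k); apply/eqP; rewrite eqn_leq h ml.
have msurj (A : {set I}) : #|A|.+2 <= #|I| -> ~ (t \subset m @: A).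
  move=> cA /subset_leq_card; have := leq_imset_card m A => h1 h2.
  by have := leq_trans h2 h1; rewrite -(leq_add2r 2) !addn2 ct ltnNge cA.
have cI1 k : #|[set~ k]|.+1 = #|I| by rewrite cardsC1 prednK// (cardD1 k).
have msub k l : k != l -> ~ (t \subset m @: ([set~ k] :\ l)).
  move=> kl; apply: msurj; have := cardsD1 l [set~ k].
  by rewrite !inE eq_sym kl add1n => <-; rewrite cI1.
have tm : t \subset m @: setT.
  apply/subsetP => x xt; have [i hi] := dt x.
  by apply/imsetP; exists i => //; apply: mE => //; exact: hi.
have [i [j [ij mij]]] : exists i j, i != j /\ m i = m j.
  have : ~~ injectiveb m.
    apply/negP => /injectiveP inj; have := card_imset predT inj.
    have -> : #|m @: predT| = #|t|.
      apply: eq_card => x; apply/imsetP/idP => [[k _ ->]//|xt].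
      by have /imsetP[k _ ->] := subsetP tm x xt; exists k.
    by move=> e; move: ct; rewrite e; apply/eqP; rewrite neq_ltn ltnSn orbT.
  by case/injectivePn => i [j ij mij]; exists i, j.
have tmD a b : a != b -> m a = m b -> t \subset m @: [set~ a].
  move=> ab mab; apply/subsetP => x xt.
  have /imsetP[k _ ->] := subsetP tm x xt; apply/imsetP.
  have [ka|ka] := eqVneq k a; last by exists k => //; rewrite !inE.
  by exists b; [rewrite !inE eq_sym|rewrite ka].
(* Adding a point of [B k] leaves every minimum [m l] with [l != k] in place. *)
pose B k := [set y | [forall l, (l != k) ==> (r l (m l) < r l y)]].
have BP k y : reflect (forall l, l != k -> r l (m l) < r l y) (y \in B k).
  rewrite inE; apply: (iffP forallP) => h l; first by move=> lk; exact: (implyP (h l)).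
  by apply/implyP; exact: h.
have B0 k : exists y, y \in B k.
  have [y hy] := above k; exists y; apply/BP => l lk.
  by have [x xt] := hy l lk; apply: leq_ltn_trans; exact: ml.
have [p pP] : exists p, forall k,
    p k \in B k /\ forall y, y \in B k -> r k y <= r k (p k).
  suff h k : exists x, x \in B k /\ forall y, y \in B k -> r k y <= r k x.
    exact: (fin_all_exists h).
  have [y0 y0B] := B0 k.
  by case: (@arg_maxnP _ y0 (mem (B k)) (r k) y0B) => z zB h; exists z.
have pB k : p k \in B k by have [] := pP k.
have pmax k y : y \in B k -> r k y <= r k (p k) by have [_] := pP k; exact.
have pnot a b : a != b -> m a = m b -> p a \notin t.
  move=> ab mab; apply/negP => /(subsetP (tmD a b ab mab)) /imsetP[k].
  by rewrite !inE => ka e; have /BP/(_ k ka) := pB a; rewrite e ltnn.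
have pdom a b : a != b -> m a = m b -> dominant (p a |: t).
  move=> ab mab; apply/dominantP => z.
  have [zB|zB] := boolP (z \in B a).
    exists a => x; rewrite in_setU1 => /orP[/eqP ->|xt]; first exact: pmax.
    have [l hl] := dt z; have [<-|la] := eqVneq l a; first exact: hl.
    by have /BP/(_ l la) := zB; rewrite ltnNge (hl _ (mt l)).
  move: zB; rewrite inE negb_forall => /existsP[l]; rewrite negb_imply -leqNgt.
  move=> /andP[la h]; exists l => x; rewrite in_setU1 => /orP[/eqP ->|xt].
    by apply: leq_trans h _; apply: ltnW; have /BP := pB a; exact.
  by apply: leq_trans h _; exact: ml.
have pij : p i != p j.
  apply/eqP => e; have [l] := dt (p i); have [->|li] := eqVneq l i => hl.
    have /BP/(_ i ij) := pB j; rewrite -e ltnNge.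
    by rewrite hl.
  by have /BP/(_ l li) := pB i; rewrite ltnNge hl.
rewrite (_ : [set _ | _] = [set p i; p j]) ?cards2 ?pij//.
have ji : j != i by rewrite eq_sym.
apply/setP => y; rewrite !inE; apply/andP/orP; last first.
  by case=> /eqP ->; split;
    [exact: pnot ij _|exact: pdom ij _|exact: pnot ji _|exact: pdom ji _].
move=> [yt /dominantP dy].
have [k hk] := dy y.
(* Once [y] is lowest for [l], no point of [t] can be lowest for [l] in [y |: t], so the other
   orders have to cover [t]. *)
have cov l : r l y <= r l (m l) -> t \subset m @: [set~ l].
  move=> hl; apply/subsetP => x xt; have [q hq] := dy x.
  have xm : x = m q by apply: mE => //; apply: hq; rewrite in_setU1 mt orbT.
  apply/imsetP; exists q => //; rewrite !inE; apply/eqP => ql.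
  have := hq y; rewrite in_setU1 eqxx => /(_ isT); rewrite ql.
  move=> h; have e : y = x.
    by apply: (@r_inj l); apply/eqP; rewrite eqn_leq h xm ql hl.
  by move: yt; rewrite e xt.
have ck : t \subset m @: [set~ k] by apply: cov; apply: hk; rewrite in_setU1 mt orbT.
(* If [y] were below the minimum for a second order as well, the remaining orders would be too few
   to cover [t]. *)
have yB : y \in B k.
  apply/BP => l lk; rewrite ltnNge; apply/negP => hl.
  apply: (@msub k l); first by rewrite eq_sym.
  apply/subsetP => x xt; have [q hq] := dy x.
  have xm : x = m q by apply: mE => //; apply: hq; rewrite in_setU1 mt orbT.
  have yq : r q y <= r q (m q) -> False.
    move=> h; have := hq y; rewrite in_setU1 eqxx => /(_ isT) h'.
    move: yt; suff -> : y = x by rewrite xt.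
    by apply: (@r_inj q); apply/eqP; rewrite eqn_leq h' xm h.
  apply/imsetP; exists q => //; rewrite !inE; apply/andP; split; apply/eqP => e.
    by apply: yq; rewrite e.
  by apply: yq; rewrite e; apply: hk; rewrite in_setU1 mt orbT.
have kij : (k == i) || (k == j).
  apply: contraT => /norP[ki kj]; exfalso; apply: (@msub k i ki).
  apply/subsetP => x /(subsetP ck)/imsetP[q]; rewrite !inE => qk ->.
  have [qi|qi] := eqVneq q i; last by apply/imsetP; exists q; rewrite ?inE ?qi.
  by apply/imsetP; exists j; rewrite ?inE ?qi// ji eq_sym.
have -> : y = p k.
  apply: (@r_inj k); apply/eqP; rewrite eqn_leq pmax//=.
  have [l hl] := dy (p k); have [lk|lk] := eqVneq l k.
    by move: hl; rewrite lk; apply; rewrite in_setU1 eqxx.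
  have /BP/(_ l lk) := pB k; rewrite ltnNge hl// in_setU1 mt orbT//.
by case/orP: kij => /eqP ->; rewrite eqxx; [left|right].
Qed.

Section Labels.
Variables (l : Y -> I) (i0 : I).

(** If removing [x] leaves exactly the labels other than [i0], then [l] is injective on the rest and
    [l x] repeats one of its labels, since [l x = i0] would complete the label set. The repetition
    is with a single [x'], so that exactly the two facets opposite [x] and [x'] qualify. *)
Lemma even_labelled_facets s : #|s| = #|I| -> l @: s != setT ->
  ~~ odd #|[set y in s | l @: (s :\ y) == [set~ i0]]|.
Proof.
move=> cs nl; have [->|/set0Pn[x]] := eqVneq [set y in s | l @: (s :\ y) == [set~ i0]] set0.
  by rewrite cards0.
rewrite !inE => /andP[xs /eqP lx].
have cI : #|[set~ i0]|.+1 = #|I| by rewrite cardsC1 prednK// (cardD1 i0).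
have inj : {in s :\ x &, injective l}.
  apply/imset_injP; rewrite lx; apply/eqP; apply: succn_inj.
  by rewrite cI -cs (cardsD1 x s) xs.
have sE : l @: s = l x |: l @: (s :\ x) by rewrite -imsetU1 setD1K.
have lxi : l x != i0.
  by apply: contra nl => /eqP e; rewrite sE lx e setUCr.
have : l x \in l @: (s :\ x) by rewrite lx !inE.
case/imsetP => x' x's e.
rewrite (_ : [set y in s | _] = [set x; x']); last first.
  apply/setP => y; rewrite !inE; apply/andP/orP; last first.
    case=> /eqP ->; first by rewrite xs lx eqxx.
    have x'S : x' \in s by move: x's; rewrite !inE => /andP[].
    split=> //; rewrite -lx; apply/eqP/setP => i.
    apply/imsetP/imsetP => -[z]; rewrite !inE => /andP[zx zs] ->.
      have [zx0|zx0] := eqVneq z x; last by exists z => //; rewrite !inE zx0.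
      by exists x' => //; rewrite zx0.
    have [zx0|zx0] := eqVneq z x'; last by exists z => //; rewrite !inE zx0.
    exists x; last by rewrite zx0.
    by rewrite !inE xs; move: x's; rewrite !inE eq_sym => /andP[->].
  move=> [ys /eqP ly]; have [->|yx] := eqVneq y x; [by left|right].
  have [//|yx'] := eqVneq y x'.
  have : l y \in l @: (s :\ y).
    rewrite ly -lx; apply/imsetP; exists y => //; by rewrite !inE yx.
  case/imsetP => z; rewrite !inE => /andP[zy zs] lyz.
  have [zx|zx] := eqVneq z x.
    have e' : y = x' by apply: inj => //; [rewrite !inE yx|rewrite lyz zx].
    by move: yx'; rewrite e' eqxx.
  have e' : z = y by apply: inj => //; rewrite !inE ?zx ?yx.
  by move: zy; rewrite e' eqxx.
rewrite cards2 (_ : x != x')//; move: x's; rewrite !inE eq_sym => /andP[]//.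
Qed.

(* Scarf's form of Sperner's lemma: the [z i] are slack points, each lowest for
   its own order and above all genuine points for the other orders. *)
Lemma full_dominant_set (z : I -> Y) (y0 : Y) :
  (forall i y, y != z i -> r i (z i) < r i y) ->
  (forall k i x, k != i -> x \notin codom z -> r k x < r k (z i)) ->
  y0 \notin codom z -> (forall i, l (z i) = i) ->
  exists s, [/\ #|s| = #|I|, dominant s & l @: s = setT].
Proof.
move=> zbot ztop y0z lz.
have zinj : injective z by move=> a b e; rewrite -(lz a) e lz.
have cI : #|[set~ i0]|.+1 = #|I| by rewrite cardsC1 prednK// (cardD1 i0).
pose full s := (#|s| == #|I|) && (dominant s) && (l @: s == setT).
have [/existsP[s /andP[/andP[/eqP c d] /eqP e]]|/existsPn nofull] :=
  boolP [exists s, full s].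
  by exists s; split.
exfalso.
pose door t := (#|t|.+1 == #|I|) && (l @: t == [set~ i0]).
pose t0 := z @: [set~ i0].
have t0door : door t0.
  apply/andP; split; first by rewrite card_imset// cI.
  apply/eqP/setP => i; apply/imsetP/idP => [[y /imsetP[k ki ->] ->]|ii0].
    by rewrite lz.
  by exists (z i); [exact: imset_f|rewrite lz].
(* Incidences of doors with the dominant sets of [#|I|] points (rooms), counted both ways. Without a
   fully labelled room the right-hand side is even by [even_labelled_facets]. The left-hand side is
   odd: [t0] opens into one room, every other door into none or two. *)
have inc : \sum_(t | door t) #|[set y | (y \notin t) && dominant (y |: t)]| =
   \sum_(s : {set Y} | (#|s| == #|I|) && dominant s)
     #|[set y in s | l @: (s :\ y) == [set~ i0]]|.
  under eq_bigr do rewrite -sum1dep_card.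
  under [RHS]eq_bigr do rewrite -sum1dep_card.
  rewrite (exchange_big_dep predT)//= [RHS](exchange_big_dep predT)//=.
  apply: eq_bigr => y _.
  rewrite [RHS](reindex_onto (fun t => y |: t) (fun s => s :\ y)) /=; last first.
    by move=> s /andP[_ /andP[ys _]]; rewrite setD1K.
  apply: eq_bigl => t; have [yt|yt] := boolP (y \in t).
    rewrite /= andbF; apply/esym/negbTE; rewrite !negb_and; apply/orP; right.
    by apply/eqP => e; move: yt; rewrite -e !inE eqxx.
  by rewrite /door setU1K// eqxx setU11 andbT cardsU1 yt add1n;
    do !case: (_ == _); rewrite ?andbF ?andbT.
have : odd (\sum_(t | door t) #|[set y | (y \notin t) && dominant (y |: t)]|); last first.
  rewrite inc; apply/negP; elim/big_ind : _ => //.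
    by move=> a b; rewrite oddD => /negbTE -> /negbTE ->.
  move=> s /andP[/eqP cs ds]; apply: even_labelled_facets => //.
  by have := nofull s; rewrite /full cs eqxx ds.
rewrite (bigD1 t0)//= oddD.
have -> : odd (\sum_(t | door t && (t != t0))
    #|[set y | (y \notin t) && dominant (y |: t)]|) = false.
  apply/negbTE; elim/big_ind : _ => //.
    by move=> a b; rewrite oddD => /negbTE -> /negbTE ->.
  move=> t /andP[/andP[/eqP ct /eqP lt_] tt0].
  have [->|/set0Pn[y]] := eqVneq [set y | (y \notin t) && dominant (y |: t)] set0.
    by rewrite cards0.
  rewrite inE => /andP[yt yd].
  (* A genuine point [x] of [t] lies below [z i] for every order but [i], as [card_extensions2]
     requires. A door made of slack points only, with all labels but [i0], is [t0]. *)
  have [/existsP[x /andP[xt xz]]|/existsPn h] := boolP [exists x in t, x \notin codom z].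
    rewrite card_extensions2//.
    - by apply: dominantS yd; exact: subsetUr.
    - by apply/set0Pn; exists x.
    - by move=> i; exists (z i) => k ki; exists x => //; exact: ztop.
  move: tt0; rewrite eqEcard.
  have -> : #|t0| <= #|t| by rewrite -ltnS ct card_imset// cI.
  rewrite andbT => /subsetPn[x xt]; case/negP.
  have := h x; rewrite xt /= negbK => /codomP[i xi].
  rewrite xi; apply: imset_f; rewrite -(lz i) -xi -lt_; exact: imset_f.
rewrite addbF.
(* The only room behind [t0] adds the genuine point that is highest for [i0]. *)
pose p := [arg max_(y > y0 | y \notin codom z) r i0 y].
have [pz pmax] : p \notin codom z /\ forall y, y \notin codom z -> r i0 y <= r i0 p.
  by rewrite /p; case: arg_maxnP.
have pt0 : p \notin t0.
  by apply: contra pz => /imsetP[k _ ->]; exact: codom_f.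
rewrite (_ : [set _ | _] = [set p]) ?cards1//; apply/setP => y; rewrite !inE.
apply/andP/eqP => [[yt /dominantP dy]|->].
  have [k hk] := dy p.
  have ki : k = i0.
    apply/eqP; apply: contraT => ki.
    have := hk (z k); rewrite in_setU1 imset_f ?inE// orbT => /(_ isT).
    by rewrite leqNgt zbot//; apply: contra pz => /eqP ->; exact: codom_f.
  have := hk y; rewrite in_setU1 eqxx ki => /(_ isT) h.
  have yz : y \notin codom z.
    apply/negP => /codomP[i yi]; have [ii|ii] := eqVneq i i0; last first.
      by move: yt; rewrite yi imset_f ?inE.
    move: h; rewrite yi ii leqNgt zbot//.
    by apply: contra pz => /eqP ->; exact: codom_f.
  by apply: (@r_inj i0); apply/eqP; rewrite eqn_leq h pmax.
split=> //; apply/dominantP => w.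
have [/codomP[k ->]|wz] := boolP (w \in codom z).
  by exists k => x _; have [->//|xk] := eqVneq x (z k); apply: ltnW; exact: zbot.
exists i0 => x; rewrite in_setU1 => /orP[/eqP ->|/imsetP[k]]; first exact: pmax.
by rewrite !inE eq_sym => ki ->; apply: ltnW; exact: ztop.
Qed.

End Labels.
End DominantSets.

(** * Small labelled sets in a grid on the simplex *)

Section Brouwer.

(** Scarf's lemma is applied to [X] with one slack point [inr i] per order, and the slack points are
    dropped afterwards. If the label [i] is missing from [S], then [inr i] belongs to the dominant
    set and is lowest for [i], so order [i] cannot witness dominance at a genuine point: the witness
    always carries a label of [S]. *)
Lemma labelled_dominant_set (I X : finType) (c : I -> X -> nat) (l : X -> I) (x0 : X) :
  exists2 S : {set X}, S != set0 &
    forall y, exists2 i, i \in l @: S & forall x, x \in S -> c i y <= c i x.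
Proof.
(* Positions in a list sorted along [c i] break the ties of [c i], as the orders have to be
   injective. *)
pose s i := sort (relpre (c i) leq) (enum X).
have sx i x : x \in s i by rewrite mem_sort mem_enum.
have ss i x : index x (s i) < #|X|.
  by rewrite cardE -(size_sort (relpre (c i) leq)) index_mem sx.
have s_le i x y : index x (s i) <= index y (s i) -> c i x <= c i y.
  apply: (@sorted_leq_index _ (relpre (c i) leq)) => //.
  - by move=> a b e; exact: leq_trans.
  - by move=> a; exact: leqnn.
  - by apply: sort_sorted => a b; exact: leq_total.
(* The successor keeps rank 0 free for the slack point of order [i]; the other slack points are
   ranked above all of [X]. *)
pose r i (y : X + I) := match y with
  | inl x => (index x (s i)).+1
  | inr j => if j == i then 0 else #|X|.+1 + enum_rank j end.
have r_inj i : injective (r i).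
  move=> [x|j] [x'|j'] /=.
  - by move=> [] e; congr inl; rewrite -(nth_index x (sx i x)) e nth_index.
  - by case: ifP => // _ [] e; move: (ss i x); rewrite e ltnNge leq_addr.
  - by case: ifP => // _ [] e; move: (ss i x'); rewrite -e ltnNge leq_addr.
  - case: eqP => [->|_]; case: eqP => [->|_] // /addnI e.
    by congr inr; apply: enum_rank_inj; exact: val_inj.
pose l' (y : X + I) := match y with inl x => l x | inr j => j end.
have inlz x : inl x \notin codom (@inr X I) by apply/negP => /codomP[].
have [|||t [ct /dominantP dt lt]] :=
    @full_dominant_set I _ r r_inj l' (l x0) inr (inl x0) _ _ (inlz x0) _ => //.
- by move=> i [x|j] /=; rewrite ?eqxx//; case: (eqVneq j i) => [->|//]; rewrite eqxx.
- move=> k i [x|j] ki; last by rewrite codom_f.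
  by move=> _ /=; rewrite eq_sym (negbTE ki) ltnS; apply: leq_trans (leq_addr _ _); exact: ss.
pose S := [set x | inl x \in t].
have lS i : inr i \notin t -> i \in l @: S.
  move=> it; have : i \in l' @: t by rewrite lt.
  case/imsetP => -[x|j] xt e; last by move: it; rewrite e xt.
  by apply/imsetP; exists x; rewrite ?inE.
have key y : exists2 i, i \in l @: S & forall x, x \in S -> c i y <= c i x.
  have [i hi] := dt (inl y); exists i.
    by apply: lS; apply/negP => it; have := hi _ it; rewrite /= eqxx.
  by move=> x; rewrite inE => /hi /=; exact: s_le.
exists S => //; apply/eqP => S0; have [i] := key x0.
by rewrite S0 imset0 inE.
Qed.

Variables (n M : nat).

(** Barycentric coordinates, multiplied by [M], of the points of the simplex with denominator
    [M]. *)
Definition grid := {k : {ffun 'I_n.+1 -> 'I_M.+1} | \sum_i (k i : nat) == M}.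

Lemma grid_mk (g : 'I_n.+1 -> nat) : \sum_i g i = M ->
  exists x : grid, forall i, val x i = g i :> nat.
Proof.
move=> gM; have gi i : g i < M.+1 by rewrite ltnS -gM (bigD1 i)//= leq_addr.
have hk : \sum_i ([ffun i => Ordinal (gi i)] i : nat) == M.
  by under eq_bigr do rewrite ffunE; rewrite gM.
by exists (exist _ [ffun i => Ordinal (gi i)] hk) => i; rewrite /= ffunE.
Qed.

(** Let [C] be the set of labels of [S] and [m i] the least [i]-th coordinate on [S]. If the numbers
    [m i + 1] over [C] summed to at most [M], some grid point would exceed [m i] for every [i] in
    [C], against dominance. So the [m i] over [C] sum to more than [M - (n + 1)], which leaves at
    most [n + 1] for the excess over [m i] of a coordinate in [C] and for a coordinate outside
    [C]. *)
Lemma small_labelled_set (l : grid -> 'I_n.+1) :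
  exists2 S : {set grid}, S != set0 &
    (forall x y i, x \in S -> y \in S -> val x i <= val y i + n.+1) /\
    (forall x i, x \in S -> n.+1 < val x i -> exists2 y, y \in S & l y = i).
Proof.
have [|x0 _] := @grid_mk (fun i => if i == ord0 then M else 0).
  by rewrite -big_mkcond big_pred1_eq.
have [S S0 dS] := labelled_dominant_set (fun i (x : grid) => val x i : nat) l x0.
exists S => //; set C := l @: S in dS.
have /set0Pn[x1 x1S] := S0.
pose m i := val [arg min_(x < x1 in S) (val x i : nat)] i : nat.
have ml x i : x \in S -> m i <= val x i.
  by rewrite /m => xS; case: arg_minnP => // y _; apply.
have mS i : exists2 x, x \in S & m i = val x i.
  by rewrite /m; case: arg_minnP => // y yS _; first by exists y.
have sumx (x : grid) : \sum_i (val x i : nat) = M by apply/eqP; exact: (valP x).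
have big : M < \sum_(i in C) (m i).+1.
  rewrite ltnNge; apply/negP => le.
  pose rest := M - \sum_(i in C) (m i).+1.
  have [|y hy] := @grid_mk (fun i => (if i \in C then (m i).+1 else 0) +
                      (if i == ord0 then rest else 0)).
    by rewrite big_split/= -!big_mkcond big_pred1_eq subnKC.
  have [i iC hi] := dS y; have [x xS mx] := mS i.
  by have := hi x xS; rewrite hy iC -mx addSn ltnNge leq_addr.
have big' : M < \sum_(i in C) m i + n.+1.
  apply: leq_trans big _; under eq_bigr do rewrite -addn1.
  rewrite big_split/= leq_add2l sum1_card -[leqRHS]card_ord; exact: max_card.
have inC x i : x \in S -> i \in C -> val x i <= m i + n.+1.
  move=> xS iC; rewrite -(leq_add2r (\sum_(j in C | j != i) m j)).
  rewrite addnAC -[X in _ <= X + _](bigD1 i)//=.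
  apply: (leq_trans _ (leq_trans (eq_leq (sumx x)) (ltnW big'))).
  rewrite [leqRHS](bigID (mem C))/=.
  rewrite [X in _ <= X + _](bigD1 i)//= -addnA leq_add2l.
  apply: leq_trans (leq_addr _ _).
  by apply: leq_sum => j _; exact: ml.
have outC x i : x \in S -> i \notin C -> val x i <= n.+1.
  move=> xS iC; rewrite -(leq_add2l (\sum_(j in C) m j)).
  apply: (leq_trans _ (leq_trans (eq_leq (sumx x)) (ltnW big'))).
  rewrite [leqRHS](bigID (mem C))/=.
  apply: leq_add; first by apply: leq_sum => j _; exact: ml.
  by rewrite (bigD1 i)//= leq_addr.
split=> [x y i xS yS|x i xS xi].
  have [iC|iC] := boolP (i \in C).
    by apply: leq_trans (inC x i xS iC) _; rewrite leq_add2r ml.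
  by apply: leq_trans (outC x i xS iC) (leq_addl _ _).
have /imsetP[y yS ->] : i \in C.
  by apply: contraT => iC; move: xi; rewrite ltnNge outC.
by exists y.
Qed.

End Brouwer.

From mathcomp Require Import all_classical all_reals all_analysis.
From mathcomp Require Import finmap ring lra.

Import Order.TTheory GRing.Theory Num.Theory.
Import numFieldNormedType.Exports.

Local Open Scope classical_set_scope.
Local Open Scope ring_scope.

(** * Fixed point theorems of Brouwer, Schauder and Krasnoselskii *)

Section Simplex.
Context {R : realType}.
Variable n : nat.

Definition simplex : set 'rV[R]_n.+1 :=
  [set x | (forall i, 0 <= x 0 i) /\ \sum_i x 0 i = 1].

Lemma compact_simplex : compact simplex.
Proof.
have cD : compact [set v : 'rV[R]_n.+1 | forall i, [set` `[0 : R, 1]] (v ord0 i)].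
  have := @rV_compact R n.+1 (fun=> [set` `[0 : R, 1]]).
  by apply => i; exact: segment_compact.
apply: (@subclosed_compact _ _ _ _ cD).
- have -> : simplex = (\bigcap_i ((fun x : 'rV[R]_n.+1 => x 0 i) @^-1` [set y | 0 <= y])) `&`
      ((fun x : 'rV[R]_n.+1 => \sum_i x 0 i) @^-1` [set 1]).
    by apply/seteqP; split => x /= [h1 h2]; split => // i; [move=> _|]; exact: h1.
  apply: closedI.
    apply: closed_bigI => i _; apply: closed_comp; last exact: closed_ge.
    by move=> x _; exact: coord_continuous.
  apply: closed_comp; last exact: closed_eq.
  by move=> x _; exact: (cvg_big (P:=xpredT) add_continuous _
    (fun i _ => @coord_continuous _ _ _ _ i x)).
- move=> x [x0 x1] i /=; rewrite in_itv/= x0 -x1 (bigD1 i)//= lerDl.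
  by apply: sumr_ge0.
Qed.

(** A grid point is labelled by some [i] with [x_i <= f(x)_i], which exists because both sides sum
    to 1. At a cluster point [z] of ever smaller labelled sets [z_i <= f(z)_i] for all [i], and
    equality of the sums makes [z] fixed. Only labels of coordinates that are not tiny are
    available, which suffices since [f(z)_i < z_i] forces [z_i > 0]. *)
Theorem brouwer_simplex (f : 'rV[R]_n.+1 -> 'rV[R]_n.+1) :
  (forall x, simplex x -> simplex (f x)) ->
  (forall x i, simplex x ->
     (fun y => f y 0 i) @ within simplex (nbhs x) --> f x 0 i) ->
  exists2 x, simplex x & f x = x.
Proof.
move=> fD fc.
have sum_le (x y : 'rV[R]_n.+1) : simplex x -> simplex y ->
    (forall i, x 0 i <= y 0 i) -> y = x.
  move=> [_ x1] [_ y1] xy; apply/rowP => i; apply/eqP; rewrite -subr_eq0.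
  have : \sum_i (y 0 i - x 0 i) == 0 by rewrite sumrB x1 y1 subrr.
  rewrite psumr_eq0 => [/allP/(_ i)|j _]; last by rewrite subr_ge0.
  by rewrite mem_index_enum; exact.
have approx k : exists p, simplex p /\ forall i, n.+1%:R / k.+1%:R < p 0 i ->
    exists q, [/\ simplex q, q 0 i <= f q 0 i &
      forall j, `|p 0 j - q 0 j| <= n.+1%:R / k.+1%:R].
  pose pt (x : grid n k.+1) : 'rV[R]_n.+1 := \row_i ((val x i : nat)%:R / k.+1%:R).
  have k0 : 0 < k.+1%:R :> R by rewrite ltr0n.
  have ptD x : simplex (pt x).
    split=> [i|]; first by rewrite mxE divr_ge0// ler0n.
    under eq_bigr do rewrite mxE.
    rewrite -mulr_suml -natr_sum (eqP (valP x)) divff//; exact: lt0r_neq0.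
  have /choice[lab hlab] : forall x, exists i, pt x 0 i <= f (pt x) 0 i.
    move=> x; apply: contrapT => /forallNP h.
    have e := sum_le _ _ (fD _ (ptD x)) (ptD x) (fun i => ltW _).
    have : pt x = f (pt x).
      by apply: e => i; rewrite ltNge; apply/negP; exact: h.
    by move=> e'; apply: (h ord0); rewrite -e' lexx.
  have [S /set0Pn[x xS] [Sc Sl]] := small_labelled_set lab.
  exists (pt x); split=> // i; rewrite mxE ltr_pM2r ?invr_gt0// ltr_nat => xi.
  have [y yS yi] := Sl x i xS xi; exists (pt y); split=> //.
    by rewrite -yi; exact: hlab.
  move=> j; rewrite !mxE -mulrBl normrM [X in _ * X]gtr0_norm ?invr_gt0//.
  rewrite ler_pM2r ?invr_gt0// ler_norml lerNl opprB.
  by rewrite !lerBlDr -!natrD !ler_nat addnC Sc// addnC Sc.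
have [p hp] := choice approx.
have [z [zD zc]] : simplex `&` cluster (p @ \oo) !=set0.
  apply: compact_simplex; exists 0%N => // k _; by have [] := hp k.
exists z => //; apply: sum_le => //; first exact: fD.
move=> i; rewrite leNgt; apply/negP => fz.
have zi : 0 < z 0 i by apply: le_lt_trans fz; exact: (fD z zD).1.
have : \forall x \near within simplex (nbhs z), f x 0 i < x 0 i.
  have c : (fun x => f x 0 i - x 0 i) @ within simplex (nbhs z) --> f z 0 i - z 0 i.
    apply: cvgB; first exact: fc.
    by apply: cvg_within_filter; exact: coord_continuous.
  have : f z 0 i - z 0 i < 0 by rewrite subr_lt0.
  move=> /(cvgr_lt _ c); apply: filterS => x; by rewrite subr_lt0.
rewrite near_withinE => /nbhs_ballP[e /= e0 he].
(* The bound [z_i / 2] makes the [i]-th coordinate of [p k] exceed the mesh, so that label [i]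
   occurs nearby; the bound [e / 2] keeps the point with that label in the ball. *)
pose d := Num.min (e / 2) (z 0 i / 2).
have d0 : 0 < d by rewrite lt_min !divr_gt0.
have [K _ hK] : \forall k \near \oo, n.+1%:R / k.+1%:R < d :> R.
  have c : (fun k => n.+1%:R * k.+1%:R^-1 : R) @ \oo --> n.+1%:R * (0 : R).
    by apply: cvgM; [exact: cvg_cst|exact: cvg_harmonic].
  by apply: (cvgr_lt _ c); rewrite mulr0.
have [] := zc [set p k | k in [set k | (K <= k)%N]] (ball z d).
- by exists K => // k /= Kk; exists k.
- exact: nbhsx_ballx.
move=> _ [[k /= Kk <-]] zpk.
have zp j : `|z 0 j - p k 0 j| < d by have := zpk.2 0 j.
have dk : n.+1%:R / k.+1%:R < d := hK k Kk; have [_ hk] := hp k.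
have [|q [qD fq pq]] := hk i.
  have := zp i; rewrite ltr_norml => /andP[_ h].
  have : d <= z 0 i / 2 by rewrite ge_min lexx orbT.
  move=> h4; apply: lt_trans dk _; clearbody d; lra.
have /he/(_ qD) : ball z e q.
  split=> // a j; rewrite (ord1 a) /ball /=.
  have h1 := zp j; have h2 := pq j.
  have h3 : d <= e / 2 by rewrite ge_min lexx.
  have := ler_normD (z 0 j - p k 0 j) (p k 0 j - q 0 j).
  rewrite addrA subrK => h4; apply: le_lt_trans h4 _.
  have h5 := le_lt_trans h2 dk; clearbody d; lra.
by rewrite ltNge fq.
Qed.

End Simplex.

Lemma cvg_within_image (T U : topologicalType) (f : T -> U) (A : set T)
    (B : set U) (x : T) :
  f @ x --> f x -> (forall y, A y -> B (f y)) ->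
  f @ within A (nbhs x) --> within B (nbhs (f x)).
Proof.
move=> fx AB P hP; have h : nbhs x (f @^-1` [set y | B y -> P y]) by exact: fx.
rewrite /= /within /=; apply: filterS h => y /= h Ay; apply: h; exact: AB.
Qed.

Lemma cvg_within_subset (T U : topologicalType) (f : T -> U) (A B : set T) (x : T) :
  A `<=` B -> f @ within B (nbhs x) --> f x -> f @ within A (nbhs x) --> f x.
Proof.
move=> AB; apply: cvg_trans; apply: cvg_app.
exact: (@cvg_within_image _ _ id A B x cvg_id AB).
Qed.

Lemma cvg_maxr (R : realType) (T : Type) (F : set_system T) (FF : Filter F)
    (f g : T -> R) (a b : R) :
  f @ F --> a -> g @ F --> b -> (fun x => Num.max (f x) (g x)) @ F --> Num.max a b.
Proof.
move=> fa gb; rewrite maxr_absE; under eq_fun do rewrite maxr_absE.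
apply: cvgM; last exact: cvg_cst.
by apply: cvgD; [exact: cvgD|apply: cvg_norm; exact: cvgB].
Qed.

Lemma cvg_minr (R : realType) (T : Type) (F : set_system T) (FF : Filter F)
    (f g : T -> R) (a b : R) :
  f @ F --> a -> g @ F --> b -> (fun x => Num.min (f x) (g x)) @ F --> Num.min a b.
Proof.
move=> fa gb; rewrite minr_absE; under eq_fun do rewrite minr_absE.
apply: cvgM; last exact: cvg_cst.
by apply: cvgB; [exact: cvgD|apply: cvg_norm; exact: cvgB].
Qed.

(** * Schauder's theorem *)

Section Schauder.
Context {R : realType} {V : normedModType R}.
Implicit Types (C M : set V) (F : V -> V).

(** The cluster point is one of the images [F (x k)], since these are what lies in a compact set.
    The points [x k] come arbitrarily close to it too, so it belongs to [C] and continuity on [C]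
    makes it fixed. *)
Lemma approx_fixed_point C M F : closed C -> compact M ->
  (forall x, C x -> M (F x)) ->
  (forall x, C x -> F @ within C (nbhs x) --> F x) ->
  (forall e, 0 < e -> exists2 x, C x & `|x - F x| <= e) ->
  exists2 x, C x & F x = x.
Proof.
move=> clC cM FM Fc ap.
have /choice[x hx] : forall k, exists x, C x /\ `|x - F x| <= k.+1%:R^-1.
  by move=> k; have [|x Cx h] := ap k.+1%:R^-1; [rewrite invr_gt0|exists x].
have [z [_ zc]] : M `&` cluster ((F \o x) @ \oo) !=set0.
  by apply: cM; exists 0%N => // k _; apply: FM; have [] := hx k.
have close e : 0 < e -> exists y, [/\ C y, `|y - F y| < e & `|z - F y| < e].
  move=> e0; have [K _ hK] : \forall k \near \oo, k.+1%:R^-1 < e :> R.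
    by apply: (cvgr_lt _ cvg_harmonic).
  have [] := zc [set F (x k) | k in [set k | (K <= k)%N]] (ball z e).
  - by exists K => // k /= Kk; exists k.
  - exact: nbhsx_ballx.
  move=> _ [[k /= Kk <-]]; rewrite -ball_normE /= => zk.
  have [Cx xF] := hx k; exists (x k); split => //.
  exact: le_lt_trans xF (hK k Kk).
have dist y : `|z - y| <= `|y - F y| + `|z - F y|.
  rewrite [leRHS]addrC (distrC y (F y)); have := ler_normD (z - F y) (F y - y).
  by rewrite addrA subrK.
have Cz : C z.
  apply: clC => B /nbhs_ballP[e /= e0 eB].
  have [|y [Cy h1 h2]] := close (e / 2); first by rewrite divr_gt0.
  exists y; split => //; apply: eB; rewrite -ball_normE /=.
  have := dist y; lra.
exists z => //; apply/eqP; rewrite -subr_eq0 -normr_le0 leNgt; apply/negP.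
set e := `|F z - z| => e0.
have e20 : 0 < e / 2 by rewrite divr_gt0.
have /cvgrPdist_lt/(_ _ e20) := Fc z Cz.
rewrite near_withinE => /nbhs_ballP[d /= d0 hd].
pose m := Num.min (d / 2) (e / 2).
have m0 : 0 < m by rewrite lt_min divr_gt0.
have [md me] : m <= d / 2 /\ m <= e / 2 by rewrite !ge_min !lexx orbT.
have [y [Cy h1 h2]] := close m m0.
have hy : `|F z - F y| < e / 2.
  by apply: hd => //; rewrite -ball_normE /=; have := dist y; lra.
have := ler_normD (F z - F y) (F y - z); rewrite addrA subrK.
by rewrite -/e (distrC (F y)); lra.
Qed.

Lemma convex_comb C : (forall x y t, C x -> C y -> 0 <= t <= 1 ->
    C (t *: x + (1 - t) *: y)) ->
  forall n (w : 'I_n.+1 -> R) (y : 'I_n.+1 -> V), (forall i, 0 <= w i) ->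
    \sum_i w i = 1 -> (forall i, C (y i)) -> C (\sum_i w i *: y i).
Proof.
move=> cC; elim=> [|n IH] w y w0 w1 Cy.
  by move: w1; rewrite !big_ord1 => ->; rewrite scale1r.
pose t := w ord0; have tE : \sum_i w (lift ord0 i) = 1 - t.
  by move: w1; rewrite big_ord_recl /t => <-; rewrite addrC addKr.
have t1 : 0 <= 1 - t by rewrite -tE sumr_ge0.
rewrite big_ord_recl.
have [t1'|t1'] := eqVneq (1 - t) 0.
  rewrite [X in _ + X]big1 ?addr0.
    by move/eqP: t1'; rewrite subr_eq0 -/t => /eqP <-; rewrite scale1r.
  move=> i _; have /eqP := tE; rewrite t1' psumr_eq0// => /allP/(_ i).
  by rewrite mem_index_enum => /(_ isT)/eqP ->; rewrite scale0r.
have -> : \sum_(i < n.+1) w (lift ord0 i) *: y (lift ord0 i) =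
    (1 - t) *: \sum_(i < n.+1) (w (lift ord0 i) / (1 - t)) *: y (lift ord0 i).
  rewrite scaler_sumr; apply: eq_bigr => i _.
  by rewrite scalerA mulrCA divff// mulr1.
apply: cC => //; last by rewrite w0 -subr_ge0.
apply: IH => [i||i] //; first by rewrite divr_ge0.
by rewrite -mulr_suml tE divff.
Qed.

(** Schauder projection: tent functions around a finite [e]-net give each [F x] normalised weights,
    and [g] sends weights to weights through [cb], so that Brouwer's theorem applies on the
    simplex. *)
Theorem schauder C M F : C !=set0 -> closed C ->
  (forall x y t, C x -> C y -> 0 <= t <= 1 -> C (t *: x + (1 - t) *: y)) ->
  compact M -> (forall x, C x -> C (F x) /\ M (F x)) ->
  (forall x, C x -> F @ within C (nbhs x) --> F x) ->
  exists2 x, C x & F x = x.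
Proof.
move=> [x0 Cx0] clC cC cM FCM Fc.
apply: (approx_fixed_point clC cM) => // [x /FCM[]//|e e0].
(* The net is taken in the intersection so that its points, and hence their convex combinations, lie
   in [C]. *)
have cMC : compact (M `&` C) by exact: compact_closedI.
move: (cMC); rewrite compact_cover => /(_ V (M `&` C) (fun y => ball y e)) [||D DMC cov].
- by move=> y _; exact: ball_open.
- by move=> y yMC; exists y => //; exact: ballxx.
have covP v : (M `&` C) v -> exists2 y, y \in D & `|y - v| < e.
  by move=> /cov[y /= yD]; rewrite -ball_normE; exists y.
case sD : (enum_fset D) => [|y1 s].
  have [CF MF] := FCM _ Cx0; have [//|y] := covP (F x0).
  by rewrite -[y \in D]/(y \in enum_fset D) sD.
pose y (i : 'I_(size s).+1) := nth 0 (y1 :: s) i.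
have yD i : y i \in D by rewrite -[_ \in D]/(_ \in enum_fset D) sD mem_nth.
have Cy i : C (y i) by have /DMC/set_mem[] := yD i.
pose ph i v : R := Num.max 0 (e - `|y i - v|).
have ph0 i v : 0 <= ph i v by rewrite le_max lexx.
pose Ph v := \sum_i ph i v.
have Ph0 v : M v -> C v -> 0 < Ph v.
  move=> Mv Cv; have [//|z zD zv] := covP v.
  have zs : z \in y1 :: s by rewrite -sD.
  move: (zs); rewrite -index_mem => zi.
  rewrite /Ph (bigD1 (Ordinal zi))//= ltr_pwDl ?sumr_ge0//.
  by rewrite lt_max /y /= nth_index// subr_gt0 zv orbT.
pose cb (w : 'rV[R]_(size s).+1) := \sum_i w 0 i *: y i.
have Ccb w : simplex w -> C (cb w).
  by move=> [w0 w1]; apply: convex_comb.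
pose g (w : 'rV[R]_(size s).+1) : 'rV[R]_(size s).+1 :=
  \row_i (ph i (F (cb w)) / Ph (F (cb w))).
have FP w : simplex w -> 0 < Ph (F (cb w)).
  by move=> /Ccb /FCM[CF MF]; exact: Ph0.
have [|w i wD|w wD gw] := @brouwer_simplex R (size s) g.
- move=> w wD; have P0 := FP w wD; split=> [i|].
    by rewrite mxE divr_ge0// ltW.
  by under eq_bigr do rewrite mxE; rewrite -mulr_suml divff// lt0r_neq0.
- have cF : (F \o cb) @ within (@simplex R (size s)) (nbhs w) --> F (cb w).
    apply: cvg_comp (Fc _ (Ccb _ wD)).
    apply: cvg_within_image => //.
    have cj j : (fun v : 'rV[R]_(size s).+1 => v 0 j *: y j) @ w --> w 0 j *: y j.
      have h := @coord_continuous R 1 (size s).+1 0 j w.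
      exact: (cvgZ h (cvg_cst (y j))).
    exact: (cvg_big (P := xpredT) add_continuous _ (fun j _ => cj j)).
  have cph j : (fun v => ph j (F (cb v))) @ within (@simplex R (size s)) (nbhs w)
      --> ph j (F (cb w)).
    apply: cvg_maxr; first exact: cvg_cst.
    apply: cvgB; first exact: cvg_cst.
    by apply: cvg_norm; apply: cvgB; [exact: cvg_cst|exact: cF].
  under eq_fun do rewrite mxE.
  rewrite mxE; apply: cvgM => //.
  apply: cvgV; first by rewrite lt0r_neq0// FP.
  by apply: (cvg_big (P := xpredT) add_continuous).
exists (cb w); first exact: Ccb.
have [w0 w1] := wD.
(* A fixed weight vector vanishes at every centre at distance at least [e] from [F (cb w)]. *)
have -> : cb w - F (cb w) = \sum_i w 0 i *: (y i - F (cb w)).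
  under [RHS]eq_bigr do rewrite scalerBr.
  by rewrite sumrB -scaler_suml w1 scale1r.
apply: le_trans (ler_norm_sum _ _ _) _.
rewrite -[e]mul1r -w1 mulr_suml; apply: ler_sum => i _.
rewrite normrZ ger0_norm//.
have [wi|wi] := eqVneq (w 0 i) 0; first by rewrite wi !mul0r.
apply: ler_wpM2l => //; rewrite leNgt; apply/negP => h.
move: wi; rewrite -gw mxE /ph max_l ?mul0r ?eqxx// subr_le0; exact: ltW.
Qed.

End Schauder.

(** * Fixed points of an expansive map of a cone *)

Section ConeExpansion.
Context {R : realType} {V : normedModType R}.

(** Encloses the values of the modified maps below, which combine [T x] and [e] with bounded
    coefficients. *)
Lemma compact_lin_comb (M : set V) (e : V) (A B : R) : compact M ->
  compact [set z : V | exists a y b, [/\ 0 <= a <= A, M y, 0 <= b <= B & z = a *: y + b *: e]].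
Proof.
move=> cM.
pose h (p : R * V * R) := p.1.1 *: p.1.2 + p.2 *: e.
have -> : [set z : V | exists a y b, [/\ 0 <= a <= A, M y, 0 <= b <= B & z = a *: y + b *: e]] =
    h @` ([set` `[0, A]] `*` M `*` [set` `[0, B]]).
  apply/seteqP; split=> [z [a [y [b [ha My hb ->]]]]|_ [[[a y] b] [[/= ha My] hb] <-]].
    by exists (a, y, b) => //=; rewrite !in_itv.
  by exists a, y, b; move: ha hb; rewrite !in_itv.
apply: continuous_compact; last first.
  by apply: compact_setX; [apply: compact_setX => //|]; exact: segment_compact.
apply: continuous_subspaceT => p.
apply: cvgD; last by apply: cvgZ; [exact: cvg_snd|exact: cvg_cst].
apply: cvgZ; apply: cvg_comp; [exact: cvg_fst|exact: cvg_fst|exact: cvg_fst|exact: cvg_snd].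
Qed.

Variables (K M : set V) (N : V -> R) (T : V -> V) (e : V) (rho : R).
Hypotheses (clK : closed K) (KD : forall x y, K x -> K y -> K (x + y)).
Hypothesis KZ : forall a x, 0 <= a -> K x -> K (a *: x).
Hypotheses (Nc : continuous N) (N0 : forall x, 0 <= N x).
Hypothesis ND : forall x y, N (x + y) <= N x + N y.
Hypothesis NZ : forall a x, 0 <= a -> N (a *: x) = a * N x.
Hypotheses (TK : forall x, K x -> K (T x)) (cM : compact M).
Hypothesis Tc : forall x, K x -> T @ within K (nbhs x) --> T x.
Hypothesis TM : forall x, K x -> N x <= 2 -> M (T x).
Hypotheses (Ke : K e) (Ne : N e = 1).
Hypothesis Ne_le : forall x b, K x -> 0 <= b -> b <= N (x + b *: e).
Hypotheses (rho0 : 0 < rho) (rho1 : 2 * rho <= 1).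
Hypothesis small : forall x s, K x -> 0 < N x <= 2 * rho -> 0 <= s <= 1 -> x <> s *: T x.
Hypothesis large : forall x m, K x -> 1 <= N x -> 0 <= m -> x <> T x + m *: e.

Let rho1_2 : rho <= 1.
Proof. by move: rho0 rho1; lra. Qed.

Let clamp (t : R) := Num.min 1 (Num.max 0 t).

Let clamp01 t : 0 <= clamp t <= 1.
Proof. by rewrite /clamp ge_min lexx le_min ler01 le_max lexx. Qed.

Let clamp0 t : t <= 0 -> clamp t = 0.
Proof. by move=> t0; rewrite /clamp max_l// min_r. Qed.

Let clamp1 t : 1 <= t -> clamp t = 1.
Proof. by move=> t1; rewrite /clamp min_l// le_max t1 orbT. Qed.

(** The factor [sg] rises from 0 at [N x = rho] to 1 at [N x = 2 * rho]; [lam] rises from 0 at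
    [N x = 1] to 3 at [N x = 2]. The value 3 only has to exceed 2, so that [N (F d x) > 2] where
    [N x = 2]. *)
Let sg x := clamp (N x / rho - 1).
Let lam x := 3 * clamp (N x - 1).
Let F d x := sg x *: T x + (d + lam x) *: e.
Let C := [set x | K x /\ N x <= 2].

Let clC : closed C.
Proof.
apply: closedI => //; apply: (@preimage_closed _ _ N [set y | y <= 2]).
  by move=> x _; exact: Nc.
exact: closed_le.
Qed.

Let lam03 x : 0 <= lam x <= 3.
Proof. by have /andP[] := clamp01 (N x - 1); rewrite /lam; lra. Qed.

Let KF d x : 0 <= d -> K x -> K (F d x).
Proof.
move=> d0 Kx; have /andP[s0 _] := clamp01 (N x / rho - 1).
have /andP[l0 _] := lam03 x.
by apply: KD; apply: KZ => //; [exact: TK|exact: addr_ge0].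
Qed.

Let NF d x : 0 <= d -> K x -> d + lam x <= N (F d x).
Proof.
move=> d0 Kx; have /andP[s0 _] := clamp01 (N x / rho - 1).
have /andP[l0 _] := lam03 x.
by apply: Ne_le; [apply: KZ => //; exact: TK|exact: addr_ge0].
Qed.

Let cN (D : set V) x : N @ within D (nbhs x) --> N x.
Proof. by apply: cvg_within_filter; exact: Nc. Qed.

Let cF (D : set V) d x : D `<=` K -> K x -> F d @ within D (nbhs x) --> F d x.
Proof.
move=> DK Kx.
have cl (f : V -> R) : f @ within D (nbhs x) --> f x ->
    (fun y => clamp (f y)) @ within D (nbhs x) --> clamp (f x).
  move=> h; apply: cvg_minr; first exact: cvg_cst.
  by apply: cvg_maxr => //; exact: cvg_cst.
apply: cvgD; apply: cvgZ.
- apply: (cl (fun y => N y / rho - 1)); apply: cvgB; last exact: cvg_cst.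
  by apply: cvgM; [exact: cN|exact: cvg_cst].
- exact: cvg_within_subset DK (Tc Kx).
- apply: cvgD; first exact: cvg_cst.
  apply: cvgM; first exact: cvg_cst.
  by apply: (cl (fun y => N y - 1)); apply: cvgB; [exact: cN|exact: cvg_cst].
- exact: cvg_cst.
Qed.

(* The radial flip [x |-> |x|^2 / |F x|] turns the expansive map [F d] into a
   self-map of the ball with the same fixed points. *)
Let perturbed d : 0 < d -> 2 * d <= rho ^+ 2 ->
  exists2 x, C x /\ rho <= N x & F d x = x.
Proof.
move=> d0 drho; have d0' := ltW d0.
have NF0 x : K x -> 0 < N (F d x).
  move=> Kx; apply: lt_le_trans (NF d0' Kx).
  by have /andP[l0 _] := lam03 x; rewrite ltr_pwDl.
(* The cut at 2 keeps [G] in the ball. The maximum with [rho] prevents the origin from being a fixed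
   point of [G]. *)
pose ps x := Num.min 2 (Num.max (N x) rho ^+ 2 / N (F d x)).
have ps02 x : K x -> 0 <= ps x <= 2.
  move=> Kx; rewrite /ps ge_min lexx le_min ler0n/= divr_ge0//.
  by rewrite exprn_ge0// le_max N0.
pose G x := (ps x / N (F d x)) *: F d x.
have coef0 x : K x -> 0 <= ps x / N (F d x).
  by move=> Kx; have /andP[p0 _] := ps02 x Kx; rewrite divr_ge0.
have NG x : K x -> N (G x) = ps x.
  move=> Kx; rewrite NZ ?coef0// divfK// lt0r_neq0//; exact: NF0.
have coefle x : K x -> ps x / N (F d x) <= 2 / d.
  move=> Kx; have /andP[p0 p2] := ps02 x Kx.
  apply: ler_pM => //; first by rewrite invr_ge0.
  rewrite lef_pV2 ?posrE//; last exact: NF0.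
  apply: le_trans (NF d0' Kx).
  by have /andP[l0 _] := lam03 x; rewrite lerDl.
have [|x y t [Kx Nx] [Ky Ny] /andP[t0 t1]|x [Kx Nx]|x [Kx Nx]|x [Kx Nx] Gx] :=
  @schauder R V C _ G _ clC _
    (compact_lin_comb (e := e) (A := 2 / d) (B := 2 / d * (d + 3)) cM).
- exists 0; have K0 : K 0 by rewrite -(scale0r e); exact: KZ.
  by split => //; rewrite -(scale0r e) NZ// mul0r.
- have t1' : 0 <= 1 - t by rewrite subr_ge0.
  split; first by apply: KD; exact: KZ.
  apply: le_trans (ND _ _) _; rewrite !NZ//; nra.
- split.
    have /andP[p0 p2] := ps02 x Kx.
    by split; [apply: KZ; [exact: coef0|exact: KF]|rewrite NG].
  exists (ps x / N (F d x) * sg x), (T x), (ps x / N (F d x) * (d + lam x)).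
  have /andP[s0 s1] := clamp01 (N x / rho - 1).
  have /andP[l0 l1] := lam03 x.
  have c0 := coef0 x Kx; have c1 := coefle x Kx.
  split.
  + rewrite mulr_ge0//= -[leRHS]mulr1; exact: ler_pM.
  + exact: TM.
  + rewrite mulr_ge0 ?addr_ge0//= ler_pM// ?addr_ge0//; lra.
  + by rewrite /G /F scalerDr !scalerA.
- have cF' : F d @ within C (nbhs x) --> F d x by apply: cF => // y [].
  have cNF : (fun y => N (F d y)) @ within C (nbhs x) --> N (F d x).
    by apply: cvg_comp cF' _; exact: Nc.
  have iNF : (fun y => (N (F d y))^-1) @ within C (nbhs x) --> (N (F d x))^-1.
    by apply: cvgV => //; rewrite lt0r_neq0// NF0.
  apply: cvgZ => //; apply: cvgM => //.
  apply: cvg_minr; first exact: cvg_cst.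
  apply: cvgM => //.
  have h : (fun y => Num.max (N y) rho) @ within C (nbhs x) --> Num.max (N x) rho.
    by apply: cvg_maxr; [exact: cN|exact: cvg_cst].
  by under eq_fun do rewrite expr2; rewrite expr2; exact: cvgM.
have Nps : N x = ps x by rewrite -NG// Gx.
have NFx := NF0 x Kx.
(* For [N x <= rho] the map is constantly [d *: e], and [2 * d <= rho ^+ 2] makes [ps x = 2],
   although [N x = ps x] and [rho <= 1]. *)
have rhoN : rho < N x.
  rewrite ltNge; apply/negP => Nrho.
  have FE : F d x = d *: e.
    rewrite /F /sg /lam !clamp0; last 2 first.
    + by rewrite subr_le0; exact: le_trans Nrho rho1_2.
    + by rewrite subr_le0 ler_pdivrMr// mul1r.
    by rewrite scale0r add0r mulr0 addr0.
  have : ps x = 2.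
    by rewrite /ps max_r// FE NZ// Ne mulr1 min_l// ler_pdivlMr.
  by rewrite -Nps => h; move: Nrho rho1_2; rewrite h; lra.
have N_gt0 : 0 < N x by apply: lt_trans rhoN.
exists x; first by split => //; exact: ltW.
have psE : ps x = Num.min 2 (N x ^+ 2 / N (F d x)) by rewrite /ps max_l// ltW.
suff NFE : N (F d x) = N x.
  by rewrite -[RHS]Gx /G -Nps NFE divff ?scale1r// lt0r_neq0.
(* If the cut is active, then [N x = 2] and [N (F d x) <= 2], but [lam x = 3] there. Otherwise
   [N x = N x ^+ 2 / N (F d x)]. *)
have [h|h] := leP 2 (N x ^+ 2 / N (F d x)).
  have N2 : N x = 2 by rewrite Nps psE min_l.
  have := NF d0' Kx; rewrite /lam clamp1 ?N2; last by lra.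
  move: h; rewrite N2 ler_pdivlMr// => h; lra.
have : N x = N x ^+ 2 / N (F d x) by rewrite [LHS]Nps psE min_r// ltW.
move/(congr1 (fun z => z * N (F d x))); rewrite divfK ?lt0r_neq0// expr2.
by move/(mulfI (lt0r_neq0 N_gt0)).
Qed.

(** A fixed point of [F d] is moved by [F 0] by [d] times the norm of [e], so [F 0] has approximate
    fixed points with [rho <= N x], hence a fixed point there. By [small] it has [N x > 2 * rho], by
    [large] it has [N x < 1], and in between [F 0] equals [T]. *)
Theorem cone_expansion_fixed_point : exists x, [/\ K x, 0 < N x & T x = x].
Proof.
have clA : closed [set x | C x /\ rho <= N x].
  apply: closedI => //; apply: (@preimage_closed _ _ N [set y | rho <= y]).
    by move=> x _; exact: Nc.
  exact: closed_ge.
have [x [[Kx Nx] _]|x [[Kx Nx] _]|eps eps0|x [[Kx Nx] rN] Fx] :=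
  @approx_fixed_point R V [set x | C x /\ rho <= N x] _ (F 0) clA
    (compact_lin_comb (e := e) (A := 1) (B := 3) cM).
- exists (sg x), (T x), (lam x).
  by split; [exact: clamp01|exact: TM|exact: lam03|rewrite /F add0r].
- by apply: cF => // y [[]].
- pose d := Num.min (eps / (`|e| + 1)) (rho ^+ 2 / 2).
  have e1 : 0 < `|e| + 1 by rewrite ltr_wpDl.
  have d0 : 0 < d by rewrite lt_min !divr_gt0// exprn_gt0.
  have [|x Cx Fx] := perturbed d0.
    have : d <= rho ^+ 2 / 2 by rewrite ge_min lexx orbT.
    lra.
  exists x => //; rewrite -{1}Fx /F add0r scalerDl addrA addrAC [_ + d *: e]addrC.
  rewrite -addrA -addrA [X in _ + X]addrA subrr addr0 normrZ gtr0_norm//.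
  apply: (@le_trans _ _ (eps / (`|e| + 1) * (`|e| + 1))); last first.
    by rewrite divfK// lt0r_neq0.
  apply: ler_pM; rewrite ?(ltW d0)//; first by rewrite ge_min lexx.
  by rewrite lerDl.
have N_gt0 : 0 < N x by apply: lt_le_trans rN.
exists x; split => //.
have [l0 _] := andP (lam03 x); move: Fx; rewrite /F add0r.
have [h|h] := leP (N x) (2 * rho).
  rewrite /lam clamp0; last by rewrite subr_le0; exact: le_trans h rho1.
  rewrite mulr0 scale0r addr0 => Fx.
  by case: (@small x (sg x)); rewrite ?N_gt0//; exact: clamp01.
have -> : sg x = 1.
  by rewrite /sg clamp1// lerBrDl -[1 + 1]/2 ler_pdivlMr// ltW.
rewrite scale1r => Fx; have [h1|h1] := leP 1 (N x).
  by case: (@large x (lam x)).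
by move: Fx; rewrite /lam clamp0 ?mulr0 ?scale0r ?addr0// subr_le0 ltW.
Qed.

End ConeExpansion.

(** * Spectral radius *)

Lemma powR_invn_expn (R : realType) (a : R) (m : nat) :
  0 <= a -> (0 < m)%N -> (a `^ m%:R^-1) ^+ m = a.
Proof.
move=> a0 m0; rewrite -powR_mulrn ?powR_ge0// -powRrM mulVf ?powRr1//.
by rewrite pnatr_eq0 -lt0n.
Qed.

(** The limit is the infimum [r] of the roots. For [r < q' < q] some [a p <= q' ^+ p]; splitting off
    multiples of [p] gives [a m <= D * q' ^+ m], where [D] accounts for the remainders, and
    [(q' / q) ^+ m] eventually absorbs [D]. *)
Lemma fekete (R : realType) (a : R ^nat) :
  (forall m, 0 <= a m) -> (forall m n, a (m + n)%N <= a m * a n) ->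
  let r := limn (fun m => a m `^ m%:R^-1) in
  [/\ 0 <= r, forall m, (0 < m)%N -> r ^+ m <= a m &
      forall q, r < q -> \forall m \near \oo, a m <= q ^+ m].
Proof.
move=> a0 aM.
pose E := [set a m `^ m%:R^-1 | m in [set m | (0 < m)%N]].
have lE : has_lbound E by exists 0 => _ [m _ <-]; exact: powR_ge0.
have nE : E !=set0 by exists (a 1 `^ 1%:R^-1), 1%N.
pose r := inf E.
have r0 : 0 <= r by apply: lb_le_inf => // _ [m _ <-]; exact: powR_ge0.
have lo m : (0 < m)%N -> r <= a m `^ m%:R^-1.
  by move=> m0; apply: ge_inf => //; exists m.
have up q : r < q -> \forall m \near \oo, a m <= q ^+ m.
  move=> rq; pose q' := (r + q) / 2.
  have rq' : r < q' by rewrite /q'; lra.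
  have q'q : q' < q by rewrite /q'; lra.
  have q'0 : 0 < q' by exact: le_lt_trans rq'.
  have q0 : 0 < q by exact: lt_trans q'q.
  have [_ [p /= p0 <-] hp] := inf_lt nE rq'.
  have ap : a p <= q' ^+ p.
    rewrite -(powR_invn_expn (a0 p) p0); apply: lerXn2r; rewrite ?nnegrE ?powR_ge0 ?ltW//.
  pose D := \sum_(j < p) a j / q' ^+ j.
  have D0 : 0 <= D by apply: sumr_ge0 => j _; rewrite divr_ge0// exprn_ge0// ltW.
  have bnd m : a m <= D * q' ^+ m.
    elim/ltn_ind: m => m IH; have [mp|pm] := ltnP m p.
      rewrite -ler_pdivrMr ?exprn_gt0// /D (bigD1 (Ordinal mp))//= lerDl.
      by apply: sumr_ge0 => j _; rewrite divr_ge0// exprn_ge0// ltW.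
    rewrite -(subnKC pm); apply: le_trans (aM _ _) _.
    rewrite exprD mulrCA; apply: ler_pM => //; apply: IH.
    by rewrite ltn_subrL p0 (leq_trans p0).
  have z1 : `|q' / q| < 1.
    by rewrite ger0_norm; [rewrite ltr_pdivrMr// mul1r|exact: divr_ge0 (ltW _) (ltW _)].
  have /cvgr_lt/(_ 1 ltr01) := cvg_geometric D z1.
  apply: filterS => m; rewrite /geometric /= expr_div_n mulrA.
  rewrite ltr_pdivrMr ?exprn_gt0// mul1r => h.
  by apply: le_trans (bnd m) _; exact: ltW.
suff -> : limn (fun m => a m `^ m%:R^-1) = r.
  split=> // m m0; rewrite -[leRHS](powR_invn_expn (a0 m) m0).
  by apply: lerXn2r; rewrite ?nnegrE ?powR_ge0// lo.
apply: cvg_lim => //; apply/cvgrPdist_le => eps eps0.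
have rq : r < r + eps by rewrite ltrDl.
have q0 : 0 < r + eps by rewrite ltr_wpDl.
have [K _ hK] := up _ rq; exists (maxn K 1) => // m /=; rewrite geq_max => /andP[Km m0].
rewrite distrC ger0_norm ?subr_ge0 ?lo// lerBlDl.
rewrite -(@ler_pXn2r _ m) ?nnegrE ?powR_ge0 ?(ltW q0)//.
by rewrite powR_invn_expn//; exact: hK.
Qed.

Section SpectralRadius.
Context {R : realType} {V : normedModType R}.
Implicit Types A L : V -> V.

Lemma op_norm_ge0 A : 0 <= op_norm A.
Proof.
have A0 : [set `|A x| | x in [set x | `|x| <= 1]] `|A 0|.
  by exists 0 => //=; rewrite normr0.
have [h|h] := pselect (has_sup [set `|A x| | x in [set x | `|x| <= 1]]).
  by apply: le_trans (normr_ge0 (A 0)) (ub_le_sup h.2 A0).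
by rewrite /op_norm sup_out.
Qed.

Lemma op_norm_le A B : 0 <= B -> (forall x, `|x| <= 1 -> `|A x| <= B) -> op_norm A <= B.
Proof.
move=> B0 h; apply: ge_sup; first by exists `|A 0|, 0 => //=; rewrite normr0.
by move=> _ [x /= x1 <-]; exact: h.
Qed.

(** The bound [B] guarantees that [op_norm] is a genuine supremum and not the default value of
    [sup]. *)
Lemma le_op_norm A B : (forall x, `|A x| <= B * `|x|) ->
  (forall c x, A (c *: x) = c *: A x) -> forall x, `|A x| <= op_norm A * `|x|.
Proof.
move=> hB hZ x; have [->|x0] := eqVneq x 0.
  by apply: le_trans (hB _) _; rewrite normr0 !mulr0.
have nx : 0 < `|x| by rewrite normr_gt0.
rewrite -ler_pdivrMr// mulrC -[X in X * _]gtr0_norm ?invr_gt0// -normrZ -hZ.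
apply: ub_le_sup; last first.
  by exists (`|x|^-1 *: x) => //=; rewrite normrZ gtr0_norm ?invr_gt0// mulVf ?gt_eqF.
exists `|B| => _ [y /= y1 <-]; apply: le_trans (hB y) _.
apply: le_trans (ler_norm _) _; rewrite normrM normr_id.
by rewrite -[leRHS]mulr1 ler_wpM2l.
Qed.

Variables (L : V -> V) (B : R).
Hypothesis LB : forall x, `|L x| <= B * `|x|.
Hypothesis LZ : forall c x, L (c *: x) = c *: L x.

Let iterZ m c x : iter m L (c *: x) = c *: iter m L x.
Proof. by elim: m => //= m ->; exact: LZ. Qed.

Lemma le_op_norm_iter m x : `|iter m L x| <= op_norm (iter m L) * `|x|.
Proof.
apply: (@le_op_norm _ (`|B| ^+ m)); last exact: iterZ.
move=> y; elim: m => [|m IH] /=; first by rewrite expr0 mul1r.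
apply: le_trans (LB _) _; rewrite exprS -mulrA.
apply: (@le_trans _ _ (`|B| * `|iter m L y|)); last exact: ler_wpM2l.
by rewrite ler_wpM2r// ler_norm.
Qed.

Lemma spectral_radiusP :
  [/\ 0 <= spectral_radius L,
      forall m, (0 < m)%N -> spectral_radius L ^+ m <= op_norm (iter m L) &
      forall q, spectral_radius L < q ->
        \forall m \near \oo, op_norm (iter m L) <= q ^+ m].
Proof.
apply: fekete => [m|m n]; first exact: op_norm_ge0.
apply: op_norm_le => [|x x1]; first by rewrite mulr_ge0// op_norm_ge0.
rewrite iterD; apply: le_trans (le_op_norm_iter _ _) _.
apply: ler_wpM2l; first exact: op_norm_ge0.
apply: le_trans (le_op_norm_iter _ _) _.
by rewrite -[leRHS]mulr1 ler_wpM2l// op_norm_ge0.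
Qed.

End SpectralRadius.

(** * Green operators *)

Lemma derive1_le (R : realType) (w : R -> R) (t c : R) : derivable w t 1 ->
  (\forall h \near 0^', h^-1 * (w (h + t) - w t) <= c) -> derive1 w t <= c.
Proof.
move=> dw hc; rewrite derive1E; apply: limr_le => //.
by apply: filterS hc => h; rewrite /= /shift /= /GRing.scale /= mulr1.
Qed.

Lemma derive1_ge (R : realType) (w : R -> R) (t c : R) : derivable w t 1 ->
  (\forall h \near 0^', c <= h^-1 * (w (h + t) - w t)) -> c <= derive1 w t.
Proof.
move=> dw hc; rewrite derive1E; apply: limr_ge => //.
by apply: filterS hc => h; rewrite /= /shift /= /GRing.scale /= mulr1.
Qed.

Lemma near_dnbhs_itvoo (R : realType) (a b t : R) (P : R -> Prop) : t \in `]a, b[ ->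
  (forall h, h != 0 -> h + t \in `]a, b[ -> P h) -> \forall h \near 0^', P h.
Proof.
move=> tab hP; have := near_in_itvoo tab => /nbhs_ballP[e /= e0 he].
exists e => //= h; rewrite /= sub0r normrN => he' h0; apply: hP => //; apply: he.
by rewrite -ball_normE /= opprD addrCA subrr addr0 normrN.
Qed.

(** * The Green kernels and the cone of chord inequalities *)

Section Green.
Context {R : realType}.
Variable d : R.
Hypothesis d01 : 0 <= d <= 1.

(** The common form of [k1] ([d = 1]) and [k2] ([d = 0]), so that both boundary conditions at 1 are
    treated together. *)
Definition green (t s : R) := Num.min s t * (1 - d * Num.max s t).

Lemma green_ge0 t s : 0 <= t <= 1 -> 0 <= s <= 1 -> 0 <= green t s.
Proof.
move: d01 => /andP[d0 d1] /andP[t0 t1] /andP[s0 s1].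
by rewrite /green; case: (leP s t) => h; apply: mulr_ge0 => //; nra.
Qed.

Lemma green_le1 t s : 0 <= t <= 1 -> 0 <= s <= 1 -> green t s <= 1.
Proof.
move: d01 => /andP[d0 d1] /andP[t0 t1] /andP[s0 s1].
rewrite /green; case: (leP s t) => h.
  have : 0 <= s * (d * t) by rewrite !mulr_ge0.
  lra.
have : 0 <= t * (d * s) by rewrite !mulr_ge0.
lra.
Qed.

(** As a function of [t] the kernel is piecewise affine with slopes [1 - d * s] and [- (d * s)]. The
    bound later controls the derivative of an image of the Green operator. *)
Lemma green_lipschitz t t' s : 0 <= t <= 1 -> 0 <= t' <= 1 -> 0 <= s <= 1 ->
  `|green t s - green t' s| <= `|t - t'|.
Proof.
move: d01 => /andP[d0 d1].
wlog le : t t' / t <= t'.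
  move=> h Ht Ht' Hs; have [le|/ltW le] := leP t t'; first exact: h.
  by rewrite distrC (distrC t); exact: h.
move=> /andP[t0 t1] /andP[t0' t1'] /andP[s0 s1].
rewrite (ler0_norm (_ : t - t' <= 0)) ?subr_le0// opprB ler_norml /green.
have ds0 : 0 <= d * s by rewrite mulr_ge0.
have ds1 : d * s <= 1 by nra.
have dt0 : 0 <= d * (t' - t) by rewrite mulr_ge0// subr_ge0.
have dt1 : d * (t' - t) <= t' - t by rewrite ler_piMl// subr_ge0.
case: (leP s t) => h1; case: (leP s t') => h2; nra.
Qed.

(* The concavity of [green _ x] through its chords to the two ends of [0, 1]. *)
Lemma green_chord_l s t x : 0 <= s -> s <= t -> t <= 1 -> 0 <= x <= 1 ->
  s * green t x <= t * green s x.
Proof.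
move: d01 => /andP[d0 d1] s0 st t1 /andP[x0 x1]; rewrite /green.
case: (leP x t) => h1; case: (leP x s) => h2.
- have : 0 <= x * (t - s) by rewrite mulr_ge0// subr_ge0.
  lra.
- have : 0 <= s * (t - x) by rewrite mulr_ge0// subr_ge0.
  lra.
- by have := lt_le_trans h1 (le_trans h2 st); rewrite ltxx.
- lra.
Qed.

Lemma green_chord_r s t x : 0 <= s -> s <= t -> t <= 1 -> 0 <= x <= 1 ->
  (1 - d * t) * green s x <= (1 - d * s) * green t x.
Proof.
move: d01 => /andP[d0 d1] s0 st t1 /andP[x0 x1]; rewrite /green.
have dx : 0 <= 1 - d * x by rewrite subr_ge0; exact: mulr_ile1.
have dt : 0 <= 1 - d * t.
  by rewrite subr_ge0; apply: mulr_ile1 => //; exact: le_trans st.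
case: (leP x t) => h1; case: (leP x s) => h2.
- lra.
- have : 0 <= (1 - d * t) * (x - s) by rewrite mulr_ge0// subr_ge0 ltW.
  lra.
- by have := lt_le_trans h1 (le_trans h2 st); rewrite ltxx.
- have : 0 <= (1 - d * x) * (t - s) by rewrite mulr_ge0// subr_ge0.
  lra.
Qed.

Lemma green_ge a b t s : 0 <= a -> b <= 1 -> a <= t <= b -> a <= s <= b ->
  a * (1 - d * b) <= green t s.
Proof.
move: d01 => /andP[d0 d1] a0 b1 /andP[at_ tb] /andP[as_ sb].
have h x : x <= b -> 0 <= 1 - d * b <= 1 - d * x by move=> xb; nra.
rewrite /green; case: (leP s t) => _.
  by have /andP[h0 h1] := h t tb; exact: ler_pM.
by have /andP[h0 h1] := h s sb; exact: ler_pM.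
Qed.

(* Nonnegative functions with [w t / t] nonincreasing and [w t / (1 - d t)]
   nondecreasing on [0, 1]: unlike [cone_component], this is convex. *)
Definition chord_cone : set (R -> R) := [set w |
  (forall t, 0 <= t <= 1 -> 0 <= w t) /\
  (forall s t, 0 <= s -> s <= t -> t <= 1 ->
     s * w t <= t * w s /\ (1 - d * t) * w s <= (1 - d * s) * w t)].

Section WithWeight.
Variables (om : R -> R).
Hypothesis omE : forall t, om t = t * (1 - d * t).

Lemma le_sup_norm a b (w : c1w om a b) t : t \in `[a, b] -> `|w t| <= sup_norm a b w.
Proof. by move=> tab; apply: (ub_le_sup (c1w_has_ubound w)); exists t. Qed.

Lemma sup_norm_le (a b : R) (w : R -> R) B : a <= b ->
  (forall t, t \in `[a, b] -> `|w t| <= B) -> sup_norm a b w <= B.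
Proof.
move=> ab h; apply: ge_sup => [|_ [t tab <-]]; last exact: h.
by exists `|w a|, a => //=; rewrite in_itv/= lexx.
Qed.

Lemma sup_norm_ge0 a b (w : c1w om a b) : a <= b -> 0 <= sup_norm a b w.
Proof.
by move=> ab; apply: le_trans (normr_ge0 (w a)) (le_sup_norm _ _); rewrite in_itv/= lexx.
Qed.

Lemma der_norm_le (a b : R) (w : R -> R) B : a < b ->
  (forall t, t \in `]a, b[ -> `|om t * derive1 w t| <= B) -> der_norm om a b w <= B.
Proof.
move=> ab h; apply: ge_sup => [|_ [t tab <-]]; last exact: h.
exists `|om ((a + b) / 2) * derive1 w ((a + b) / 2)|, ((a + b) / 2) => //=.
by rewrite mid_in_itvoo.
Qed.

(** The two monotone quotients bound the difference quotients, whence [w' <= w / t] and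
    [w' >= - d * w / (1 - d * t)]. After multiplication by the weight, [om t * w' t] lies between
    [- d * t * w t] and [(1 - d * t) * w t]. *)
Lemma chord_cone_der_norm (w : c1w om 0 1) : chord_cone w ->
  der_norm om 0 1 w <= sup_norm 0 1 w.
Proof.
move: d01 => /andP[d0 d1] [w0 wc]; apply: der_norm_le => // t t01.
have [_ dw _ _ _] := c1wP w; have {}dw := dw t t01.
move: (t01); rewrite in_itv/= => /andP[t0 t1].
have wt0 : 0 <= w t by rewrite w0// !ltW.
apply: (@le_trans _ _ (w t)); last first.
  by rewrite -[leLHS]ger0_norm//; apply: le_sup_norm; rewrite in_itv/= !ltW.
have dt : d * t < 1 by nra.
have dt0 : 0 < 1 - d * t by rewrite subr_gt0.
have up : derive1 w t <= w t / t.
  apply: derive1_le => //; apply: near_dnbhs_itvoo t01 _ => h h0.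
  rewrite in_itv/= => /andP[ht0 ht1]; rewrite ler_pdivlMr//.
  have [hp|hn] := ltP 0 h.
    have [|h1 _] := wc t (h + t) (ltW t0) _ (ltW ht1); first by rewrite lerDr ltW.
    by rewrite -mulrA ler_pdivrMl//; nra.
  have {}hn : h < 0 by rewrite lt_neqAle h0.
  have [|h1 _] := wc (h + t) t (ltW ht0) _ (ltW t1); first by rewrite gerDr ltW.
  by rewrite -mulrA ler_ndivrMl//; nra.
have lo : - (d * w t) / (1 - d * t) <= derive1 w t.
  apply: derive1_ge => //; apply: near_dnbhs_itvoo t01 _ => h h0.
  rewrite in_itv/= => /andP[ht0 ht1]; rewrite ler_pdivrMr//.
  have [hp|hn] := ltP 0 h.
    have [|_ h1] := wc t (h + t) (ltW t0) _ (ltW ht1); first by rewrite lerDr ltW.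
    by rewrite -mulrA ler_pdivlMl//; nra.
  have {}hn : h < 0 by rewrite lt_neqAle h0.
  have [|_ h1] := wc (h + t) t (ltW ht0) _ (ltW t1); first by rewrite gerDr ltW.
  by rewrite -mulrA ler_ndivlMl//; nra.
move: up lo; rewrite ler_pdivlMr// ler_pdivrMr// omE => up lo.
rewrite ler_norml; apply/andP; split.
  have : t * - (d * w t) <= t * (derive1 w t * (1 - d * t)) by rewrite ler_pM2l.
  nra.
have : (1 - d * t) * (derive1 w t * t) <= (1 - d * t) * w t by rewrite ler_pM2l.
have : 0 <= d * t * w t by rewrite !mulr_ge0// ltW.
lra.
Qed.

(** Each value [w s] is compared with [w t] along the chord inequality for the end 1 if [s <= t],
    costing a factor [1 - d * t >= c], and for the end 0 otherwise, costing a factor [t >= c]. *)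
Lemma chord_cone_ge (w : c1w om 0 1) a b c t : chord_cone w -> 0 <= a -> b <= 1 ->
  0 < c -> c <= a -> c <= 1 - d * b -> a <= t <= b -> c * sup_norm 0 1 w <= w t.
Proof.
move: d01 => /andP[d0 d1] [w0 wc] a0 b1 c0 ca cb /andP[at_ tb].
have t0 : 0 <= t by exact: le_trans at_.
have t1 : t <= 1 by exact: le_trans b1.
have wt0 : 0 <= w t by rewrite w0// t0.
rewrite mulrC -ler_pdivlMr//; apply: sup_norm_le => // s.
rewrite in_itv/= => /andP[s0 s1]; have ws0 : 0 <= w s by rewrite w0// s0.
rewrite ger0_norm// ler_pdivlMr//.
have [st|/ltW ts] := leP s t.
  have [_ h] := wc s t s0 st t1.
  have : w s * c <= w s * (1 - d * t) by apply: ler_wpM2l => //; nra.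
  have : 0 <= (d * s) * w t by rewrite !mulr_ge0.
  lra.
have [h _] := wc t s t0 ts s1.
have : w s * c <= w s * t by apply: ler_wpM2l => //; exact: le_trans at_.
have : s * w t <= w t by rewrite ler_piMl.
lra.
Qed.

Lemma chord_cone_component (w : c1w om 0 1) a b c : chord_cone w -> 0 <= a ->
  a <= b -> b <= 1 -> 0 < c -> c <= a -> c <= 1 - d * b ->
  cone_component a b c w.
Proof.
move=> wc a0 ab b1 c0 ca cb; split.
- by move=> t; rewrite in_itv/=; case: wc => h _; exact: h.
- apply: lb_le_inf; first by exists (w a), a => //=; rewrite in_itv/= lexx.
  move=> _ [t /= tab <-]; apply: (@chord_cone_ge w a b) => //.
- exact: chord_cone_der_norm.
Qed.

End WithWeight.
End Green.

Lemma normr_Rintegral_le (R : realType) (a b B : R) (f : R -> R) : a <= b ->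
  lebesgue_measure.-integrable `[a, b] (EFin \o f) ->
  (forall s, s \in `[a, b] -> `|f s| <= B) ->
  `|\int[lebesgue_measure]_(s in `[a, b]) f s| <= B * (b - a).
Proof.
move=> ab fi fB; apply: le_trans (le_normr_Rintegral _ fi) _ => //.
apply: (@le_trans _ _ (\int[lebesgue_measure]_(s in `[a, b]) B)).
  apply: le_Rintegral => //; first by apply: integrable_norm.
  by apply: continuous_compact_integrable; [exact: segment_compact|move=> x; exact: cvg_cst].
rewrite Rintegral_cst//= lebesgue_measure_itv/= lte_fin; case: ltP => //= ba.
by have -> : b = a by [apply/eqP; rewrite eq_le ba ab]; rewrite subrr.
Qed.

(** * Green operators on an interval and their characteristic values *)

Section GreenOperator.
Context {R : realType}.
Variable d : R.
Hypothesis d01 : 0 <= d <= 1.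
Variables (om : R -> R) (a b : R).
Hypothesis omE : forall t, om t = t * (1 - d * t).
Hypotheses (a0 : 0 <= a) (ab : a < b) (b1 : b <= 1).
Let mu := @lebesgue_measure R.
Let op := integral_op (green d) a b.

Let sub01 t : t \in `[a, b] -> 0 <= t <= 1.
Proof.
by rewrite in_itv/= => /andP[at_ tb]; rewrite (le_trans a0 at_) (le_trans tb b1).
Qed.

Lemma integrable_green (w : R -> R) t : {within `[a, b], continuous w} ->
  mu.-integrable `[a, b] (EFin \o (fun s => green d t s * w s)).
Proof.
move=> cw; apply: continuous_compact_integrable; first exact: segment_compact.
have cid (D : set R) : {within D, continuous (id : R -> R)}.
  by apply: continuous_subspaceT => x; exact: cvg_id.
move=> x; apply: cvgM; last exact: cw.
apply: cvgM; first by apply: continuous_min; [exact: cid|exact: cvg_cst].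
apply: cvgB; first exact: cvg_cst.
apply: cvgM; first exact: cvg_cst.
by apply: continuous_max; [exact: cid|exact: cvg_cst].
Qed.

Lemma integral_opE k w t : t \in `[a, b] ->
  integral_op k a b w t = \int[mu]_(s in `[a, b]) (k t s * w s).
Proof. by move=> tab; rewrite /integral_op patchE ifT// mem_setE. Qed.

Lemma green_op_le (v w : R -> R) t : {within `[a, b], continuous v} ->
  {within `[a, b], continuous w} -> t \in `[a, b] ->
  (forall s, s \in `[a, b] -> v s <= w s) -> op v t <= op w t.
Proof.
move=> cv cw tab vw; rewrite /op !integral_opE//.
apply: le_Rintegral => //; [exact: integrable_green|exact: integrable_green|].
move=> s sab; apply: ler_wpM2l; last exact: vw.
by apply: green_ge0 => //; exact: sub01.
Qed.

Lemma green_opZ (c : R) (w : R -> R) t : {within `[a, b], continuous w} ->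
  t \in `[a, b] -> op (fun s => c * w s) t = c * op w t.
Proof.
move=> cw tab; rewrite /op !integral_opE// -RintegralZl//; last exact: integrable_green.
by under eq_Rintegral do rewrite mulrCA.
Qed.

Lemma green_op_norm_le (w : R -> R) t B : {within `[a, b], continuous w} -> 0 <= B ->
  t \in `[a, b] -> (forall s, s \in `[a, b] -> `|w s| <= B) -> `|op w t| <= B.
Proof.
move=> cw B0 tab wB; rewrite /op integral_opE//.
apply: (@le_trans _ _ (B * (b - a))).
  apply: normr_Rintegral_le; [exact: ltW|exact: integrable_green|move=> s sab].
  have g0 := green_ge0 d01 (sub01 tab) (sub01 sab).
  have g1 := green_le1 d01 (sub01 tab) (sub01 sab).
  by rewrite normrM ger0_norm// -[leRHS]mul1r; apply: ler_pM => //; exact: wB.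
by rewrite ler_piMr//; move: a0 b1; lra.
Qed.

Lemma green_op_lipschitz (w : R -> R) t t' B : {within `[a, b], continuous w} -> 0 <= B ->
  t \in `[a, b] -> t' \in `[a, b] -> (forall s, s \in `[a, b] -> `|w s| <= B) ->
  `|op w t - op w t'| <= B * `|t - t'|.
Proof.
move=> cw B0 tab tab' wB; rewrite /op !integral_opE//.
rewrite -RintegralB//; [|exact: integrable_green|exact: integrable_green].
apply: (@le_trans _ _ (B * `|t - t'| * (b - a))).
  apply: normr_Rintegral_le; first exact: ltW.
    rewrite (_ : EFin \o _ = (fun s => (green d t s * w s)%:E - (green d t' s * w s)%:E)%E).
      by apply: integrableB => //; exact: integrable_green.
    by apply/funext => s /=; rewrite EFinB.
  move=> s sab; rewrite -mulrBl normrM mulrC; apply: ler_pM => //; first exact: wB.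
  by apply: green_lipschitz => //; exact: sub01.
by rewrite ler_piMr ?mulr_ge0//; move: a0 b1; lra.
Qed.

Lemma derive1_indic t : t \in `]a, b[ -> is_derive t 1 (\1_`[a, b] : R -> R) 0.
Proof.
move=> tab; apply: (@near_eq_is_derive R R^o R^o (cst 1) (\1_`[a, b]) t 1 0).
have := near_in_itvoo tab; apply: filterS => s sab.
by rewrite indicE mem_setE (subset_itv_oo_cc sab).
Qed.

(** The constant 1, cut off outside [[a, b]] as the encoding of the space demands. Its iterates
    under the operator dominate those of the unit ball pointwise. *)
Lemma one_c1w : (\1_`[a, b] : R -> R) \in c1w_pred om a b.
Proof.
have oneE t : t \in `[a, b] -> \1_`[a, b] t = 1 :> R.
  by move=> tab; rewrite indicE mem_setE tab.
have d1E t : t \in `]a, b[ -> derive1 (\1_`[a, b] : R -> R) t = 0.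
  by move=> tab; rewrite derive1E; have [_ ->] := derive1_indic tab.
apply/mem_set; split.
- have : {within `[a, b], continuous (fun=> 1 : R)} by move=> x; exact: cvg_cst.
  by apply: subspace_eq_continuous => t; move=> /set_mem tab; rewrite /from_subspace oneE.
- by move=> t /derive1_indic[].
- move=> t tab; rewrite /continuous_at d1E//.
  have c0 : (fun=> 0 : R) @ t --> (0 : R) by exact: cvg_cst.
  apply: cvg_trans c0; apply: near_eq_cvg; have := near_in_itvoo tab.
  by apply: filterS => s sab; rewrite d1E.
- by exists 0 => _ [t tab <-]; rewrite d1E// mulr0 normr0.
- by move=> t tab; rewrite indicE mem_setE (negbTE tab).
Qed.

Definition one : c1w om a b := MkC1w one_c1w.

Lemma oneE t : t \in `[a, b] -> one t = 1.
Proof. by move=> tab; rewrite /= indicE mem_setE tab. Qed.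

Variable L : c1w om a b -> c1w om a b.
Hypothesis LE : forall w, L w = op w :> (R -> R).

Let cont (w : c1w om a b) : {within `[a, b], continuous w}.
Proof. by have [] := c1wP w. Qed.

Let LZ c w : L (c *: w) = c *: L w.
Proof.
apply/val_inj/funext => t /=; have [tab|tab] := boolP (t \in `[a, b]).
  by rewrite -[LHS]/(L (c *: w) t) LE -[c1w_fun _]/(fun s => c * w s) green_opZ// -LE.
have [_ _ _ _ h] := c1wP (L (c *: w)); have [_ _ _ _ h'] := c1wP (L w).
by rewrite -[LHS]/(L (c *: w) t) h// -[RHS]/(c * L w t) h' ?mulr0.
Qed.

(** One application of [L] controls the full norm by the supremum alone: the kernel is 1-Lipschitz
    in [t], so the derivative of [L w] is bounded by the supremum of [w], and the weight is at most
    1. *)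
Let L_sup w : `|L w| <= sup_norm a b w.
Proof.
have s0 := sup_norm_ge0 w (ltW ab).
have wB s : s \in `[a, b] -> `|w s| <= sup_norm a b w by exact: le_sup_norm.
rewrite /Num.norm/= ge_max; apply/andP; split.
  by apply: sup_norm_le => [|t tab]; [exact: ltW|rewrite LE; exact: green_op_norm_le].
apply: der_norm_le => // t tab; have tab' := subset_itv_oo_cc tab.
have [_ dL _ _ _] := c1wP (L w); have {}dL := dL t tab.
have /andP[t0 t1] := sub01 tab'; move: (d01) => /andP[d0 d1].
have om1 : 0 <= om t <= 1.
  have dt : d * t <= 1 by exact: mulr_ile1.
  have : 0 <= d * t by exact: mulr_ge0.
  by move=> dt0; rewrite omE mulr_ge0 ?subr_ge0//= mulr_ile1 ?subr_ge0//; lra.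
have /andP[m0 m1] := om1.
rewrite normrM (ger0_norm m0) -[leRHS]mul1r; apply: ler_pM => //.
have quot h : h != 0 -> h + t \in `]a, b[ ->
    `|h^-1 * (L w (h + t) - L w t)| <= sup_norm a b w.
  move=> h0 htab; rewrite normrM normfV ler_pdivrMl ?normr_gt0// mulrC !LE.
  rewrite -[X in _ * `|X|](addrK t); apply: green_op_lipschitz => //.
  exact: subset_itv_oo_cc htab.
rewrite ler_norml; apply/andP; split.
  apply: derive1_ge => //; apply: near_dnbhs_itvoo tab _ => h h0 htab.
  by have := quot h h0 htab; rewrite ler_norml => /andP[].
apply: derive1_le => //; apply: near_dnbhs_itvoo tab _ => h h0 htab.
by have := quot h h0 htab; rewrite ler_norml => /andP[].
Qed.

Let sup_le_norm (w : c1w om a b) : sup_norm a b w <= `|w|.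
Proof. by rewrite /Num.norm/= le_max lexx. Qed.

Let L_le w : `|L w| <= 1 * `|w|.
Proof. by rewrite mul1r; apply: le_trans (L_sup w) _. Qed.

Let radiusP := spectral_radiusP L_le LZ.

Let iter_le (v : R -> R) (w : c1w om a b) lam : 0 <= lam ->
  {within `[a, b], continuous v} ->
  (forall t, t \in `[a, b] -> v t <= w t) ->
  (forall t, t \in `[a, b] -> v t <= lam * op v t) ->
  forall m t, t \in `[a, b] -> v t <= lam ^+ m * iter m L w t.
Proof.
move=> l0 cv vw vl; elim=> [|m IH] t tab; first by rewrite expr0 mul1r vw.
apply: le_trans (vl t tab) _; rewrite exprS -mulrA; apply: ler_wpM2l => //=.
rewrite LE -green_opZ//; apply: green_op_le => // x.
by apply: cvgM; [exact: cvg_cst|exact: cont].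
Qed.

Let iter_ge (v : R -> R) (w : c1w om a b) lam : 0 <= lam ->
  {within `[a, b], continuous v} ->
  (forall t, t \in `[a, b] -> w t <= v t) ->
  (forall t, t \in `[a, b] -> lam * op v t <= v t) ->
  forall m t, t \in `[a, b] -> lam ^+ m * iter m L w t <= v t.
Proof.
move=> l0 cv vw vl; elim=> [|m IH] t tab; first by rewrite expr0 mul1r vw.
apply: le_trans (vl t tab); rewrite exprS -mulrA; apply: ler_wpM2l => //=.
rewrite LE -green_opZ//; apply: green_op_le => // x.
by apply: cvgM; [exact: cvg_cst|exact: cont].
Qed.

(** Iteration gives [u <= lam ^+ m * L^m u]. For [q] above the spectral radius with [lam * q < 1],
    the right-hand side is eventually at most the norm of [u] times [(lam * q) ^+ m], which tends to
    0. *)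
Lemma subsolution_le0 (u : c1w om a b) lam : 0 <= lam ->
  lam * spectral_radius L < 1 ->
  (forall t, t \in `[a, b] -> u t <= lam * op u t) ->
  forall t, t \in `[a, b] -> u t <= 0.
Proof.
move=> l0 lr ul t tab; have [r0 _ rq] := radiusP.
have [q [rq' q1]] : exists q, spectral_radius L < q /\ lam * q < 1.
  have [l00|l00] := eqVneq lam 0.
    by exists (spectral_radius L + 1); rewrite l00 mul0r ltrDl ltr01.
  have lp : 0 < lam by rewrite lt_neqAle eq_sym l00.
  exists ((spectral_radius L + lam^-1) / 2).
  have : spectral_radius L < lam^-1 by rewrite -[ltRHS]mul1r ltr_pdivlMr// mulrC.
  move=> h; split; first by lra.
  have : (spectral_radius L + lam^-1) / 2 < lam^-1 by lra.
  by move=> h'; rewrite -ltr_pdivlMl// mulr1.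
have q0 : 0 <= q by exact: le_trans (ltW rq').
have c : (fun m => `|u| * (lam * q) ^+ m) @ \oo --> (0 : R).
  by apply: cvg_geometric; rewrite ger0_norm// mulr_ge0.
rewrite leNgt; apply/negP => ut.
have /cvgr_lt/(_ _ ut) := c.
move=> h; have [K _ hK] := filterI (rq q rq') h.
have [hm um] := hK K (leqnn K); set m := K in hm um.
have := @iter_le u u lam l0 (@cont u) (fun s _ => lexx (u s)) ul m t tab.
apply/negP; rewrite -ltNge; apply: le_lt_trans um.
rewrite exprMn mulrCA; apply: ler_wpM2l; first exact: exprn_ge0.
apply: le_trans (ler_norm _) _; apply: le_trans (le_sup_norm _ tab) _.
apply: le_trans (sup_le_norm _) _; apply: le_trans (le_op_norm_iter L_le LZ _ _) _.
by rewrite mulrC ler_wpM2l.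
Qed.

(** On [[a, b]] the kernel is at least [c], so [L^m 1 >= (c * (b - a)) ^+ m], and the operator norms
    cannot decay faster. *)
Lemma spectral_radius_gt0 : 0 < a * (1 - d * b) -> 0 < spectral_radius L.
Proof.
set c := a * _ => c0; have [_ _ rq] := radiusP.
pose k := c * (b - a); have k0 : 0 < k by rewrite mulr_gt0// subr_gt0.
have lo m t : t \in `[a, b] -> k ^+ m <= iter m L one t.
  elim: m t => [|m IH] t tab; first by rewrite expr0 oneE.
  rewrite /= LE /op integral_opE//.
  apply: (@le_trans _ _ (\int[mu]_(s in `[a, b]) (c * k ^+ m))).
    rewrite Rintegral_cst//= lebesgue_measure_itv/= lte_fin ab/= exprS.
    by rewrite /k; lra.
  apply: le_Rintegral => //; last 2 first.
  - exact: integrable_green.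
  - move=> s sab; apply: ler_pM; [exact: ltW|by rewrite exprn_ge0 ?ltW| |exact: IH].
    by move: tab sab; rewrite /= !in_itv/= => tab sab; exact: green_ge.
  by apply: continuous_compact_integrable; [exact: segment_compact|move=> x; exact: cvg_cst].
have n1 : `|one| <= 1.
  rewrite /Num.norm/= ge_max; apply/andP; split.
    by apply: sup_norm_le => [|t tab]; [exact: ltW|rewrite oneE// normr1].
  apply: der_norm_le => // t tab.
  by rewrite derive1E; have [_ ->] := derive1_indic tab; rewrite mulr0 normr0.
rewrite ltNge; apply/negP => r0.
have rk : spectral_radius L < k / 2 by apply: le_lt_trans r0 _; rewrite divr_gt0.
have [K _ hK] := rq _ rk.
(* The exponent is [K.+1] because [(k / 2) ^+ m < k ^+ m] fails for [m = 0]. *)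
have := hK K.+1 (leqnSn K); apply/negP; rewrite -ltNge.
apply: (@lt_le_trans _ _ (k ^+ K.+1)).
  by apply: ltrXn2r => //; rewrite ?nnegrE; lra.
have aab : a \in `[a, b] by rewrite in_itv/= lexx ltW.
apply: le_trans (lo K.+1 a aab) _; apply: le_trans (ler_norm _) _.
apply: le_trans (le_sup_norm _ aab) _; apply: le_trans (sup_le_norm _) _.
apply: le_trans (le_op_norm_iter L_le LZ _ _) _.
by rewrite -[leRHS]mulr1 ler_wpM2l// op_norm_ge0.
Qed.

(** Iteration from [v >= kap] bounds [lam ^+ m * kap * L^m 1] by the maximum of [v]. Since [L^m 1]
    dominates [L^m w] on the unit ball, this bounds the norm of [L^(m+1)], the extra factor [L]
    taking care of the derivative part. Then [lam ^+ m * kap * r ^+ m.+1] stays bounded, against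
    [lam * r > 1]. *)
Lemma no_supersolution (v : R -> R) lam kap : 0 < a * (1 - d * b) ->
  {within `[a, b], continuous v} -> 0 < kap ->
  (forall t, t \in `[a, b] -> kap <= v t) -> 0 <= lam ->
  1 < lam * spectral_radius L ->
  (forall t, t \in `[a, b] -> lam * op v t <= v t) -> False.
Proof.
move=> c0 cv kap0 kv l0 lr vl; have [r0 ra _] := radiusP.
have rp := spectral_radius_gt0 c0.
set r := spectral_radius L in r0 ra lr rp.
have aab : a \in `[a, b] by rewrite in_itv/= lexx ltW.
have : compact (v @` `[a, b]).
  by apply: continuous_compact => //; exact: segment_compact.
move=> /compact_bounded[B0 [_ bB]].
pose B := `|B0| + 1.
have vB t : t \in `[a, b] -> v t <= B.
  move=> tab; apply: le_trans (ler_norm _) _; apply: (bB B); last by exists t.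
  by rewrite /B; apply: le_lt_trans (ler_norm _) _; rewrite ltrDl.
have one_le m t : t \in `[a, b] -> lam ^+ m * (kap * iter m L one t) <= B.
  move=> tab; apply: le_trans (vB t tab).
  have iZ : iter m L (kap *: one) = kap *: iter m L one.
    by elim: (m) => //= i ->; exact: LZ.
  have := @iter_ge v (kap *: one) lam l0 cv _ vl m t tab; rewrite iZ; apply.
  by move=> s sab; rewrite -[_ s]/(kap * one s) oneE// mulr1 kv.
have dom m (w : c1w om a b) t : `|w| <= 1 -> t \in `[a, b] ->
    `|iter m L w t| <= iter m L one t.
  move=> w1; elim: m t => [|m IH] t tab.
    rewrite oneE//; apply: le_trans (le_sup_norm _ tab) _.
    exact: le_trans (sup_le_norm _) w1.
  have cw := @cont (iter m L w); have co := @cont (iter m L one).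
  rewrite /= !LE ler_norml -mulN1r -green_opZ//.
  have IH' s : s \in `[a, b] -> - iter m L one s <= iter m L w s <= iter m L one s.
    by move=> /IH; rewrite ler_norml.
  apply/andP; split; apply: green_op_le => //.
  - by move=> x; apply: cvgM; [exact: cvg_cst|exact: co].
  - by move=> s /IH' /andP[]; rewrite mulN1r.
  - by move=> s /IH' /andP[].
have bound m : lam ^+ m * kap * r ^+ m.+1 <= B.
  apply: (@le_trans _ _ (lam ^+ m * kap * op_norm (iter m.+1 L))).
    by apply: ler_wpM2l; [rewrite mulr_ge0 ?exprn_ge0// ltW|exact: ra].
  have [l00|l00] := eqVneq (lam ^+ m) 0.
    by rewrite l00 !mul0r addr_ge0.
  have lp : 0 < lam ^+ m * kap by rewrite mulr_gt0// lt_neqAle eq_sym l00 exprn_ge0.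
  rewrite mulrC -ler_pdivlMr//; apply: op_norm_le => [|w w1].
    by rewrite divr_ge0 ?(ltW lp)// addr_ge0.
  rewrite iterS; apply: le_trans (L_sup _) _.
  apply: sup_norm_le => [|t tab]; first exact: ltW.
  apply: le_trans (dom m w t w1 tab) _.
  by rewrite ler_pdivlMr// mulrC -mulrA one_le.
have z1 : `|(lam * r)^-1| < 1.
  by rewrite gtr0_norm ?invr_gt0 ?invf_lt1// (lt_trans ltr01).
have kr : 0 < kap * r by rewrite mulr_gt0.
have /cvgr_lt/(_ _ kr)[K _ hK] := cvg_geometric B z1.
have := hK K (leqnn K); apply/negP; rewrite -leNgt /geometric/=.
rewrite exprVn ler_pdivlMr ?exprn_gt0//; last exact: lt_trans lr.
by apply: le_trans (bound K); rewrite exprMn exprS; lra.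
Qed.

Lemma char_value_ge0 : 0 <= char_value L.
Proof. by have [r0 _ _] := radiusP; rewrite invr_ge0. Qed.

(** The maximum with 0 keeps the factor nonnegative, as the monotone iteration requires, also when
    [eps] exceeds the characteristic value. *)
Lemma subsolution_char_value_le0 (u : c1w om a b) eps : 0 < eps ->
  (forall t, t \in `[a, b] -> u t <= Num.max (char_value L - eps) 0 * op u t) ->
  forall t, t \in `[a, b] -> u t <= 0.
Proof.
move=> eps0; apply: subsolution_le0; first by rewrite le_max lexx orbT.
have [r0 _ _] := radiusP; rewrite /char_value.
have [->|rn0] := eqVneq (spectral_radius L) 0; first by rewrite mulr0.
have rp : 0 < spectral_radius L by rewrite lt_neqAle eq_sym rn0.
rewrite -ltr_pdivlMr// mul1r gt_max invr_gt0 rp andbT.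
by rewrite gtrDl oppr_lt0.
Qed.

Lemma no_char_value_supersolution (v : R -> R) eta kap : 0 < a * (1 - d * b) ->
  {within `[a, b], continuous v} -> 0 < kap ->
  (forall t, t \in `[a, b] -> kap <= v t) -> 0 < eta ->
  (forall t, t \in `[a, b] -> (char_value L + eta) * op v t <= v t) -> False.
Proof.
move=> c0 cv kap0 kv eta0 vl; have rp := spectral_radius_gt0 c0.
have cp : 0 < char_value L by rewrite invr_gt0.
apply: (no_supersolution c0 cv kap0 kv _ _ vl); first by rewrite addr_ge0// ltW.
by rewrite mulrDl mulVf ?gt_eqF// ltrDl mulr_gt0.
Qed.

End GreenOperator.

Lemma in_itv01 (R : realType) (t : R) : (t \in `[0, 1]) = (0 <= t <= 1).
Proof. by rewrite in_itv. Qed.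

(** * Green potentials of a nonnegative source *)

Section NonnegativeSource.
Context {R : realType}.
Let mu := @lebesgue_measure R.
Variables (d : R) (om : R -> R) (g : R -> R).
Hypothesis d01 : 0 <= d <= 1.
Hypothesis omE : forall t, om t = t * (1 - d * t).
Hypothesis g_ge0 : forall s, s \in `[0, 1] -> 0 <= g s.
Hypothesis gi : forall t, t \in `[0, 1] ->
  mu.-integrable `[0, 1] (EFin \o (fun s => green d t s * g s)).

Let I t := \int[mu]_(s in `[0, 1]) (green d t s * g s).

Let kg_ge0 t s : t \in `[0, 1] -> s \in `[0, 1] -> 0 <= green d t s * g s.
Proof. by move=> t01 s01; rewrite mulr_ge0 ?g_ge0// green_ge0. Qed.

(** The chord inequalities of the kernel are integrated against [g >= 0]; this is how [T] lands in
    the convex cone. *)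
Lemma green_source_chord_cone (w : R -> R) :
  (forall t, t \in `[0, 1] -> w t = I t) -> chord_cone d w.
Proof.
have iZ c t : t \in `[0, 1] ->
    mu.-integrable `[0, 1] (EFin \o (fun s => c * (green d t s * g s))).
  move=> t01; rewrite (_ : EFin \o _ = (fun s => c%:E * (green d t s * g s)%:E)%E).
    by apply: integrableZl => //; exact: gi.
  by apply/funext => s /=; rewrite EFinM.
move=> wE; split=> [t t01|s t s0 st t1].
  by rewrite wE// /I; apply: Rintegral_ge0 => s s01; exact: kg_ge0.
have s01 : s \in `[0, 1] by rewrite in_itv/= s0 (le_trans st).
have t01 : t \in `[0, 1] by rewrite in_itv/= t1 (le_trans s0).
rewrite !wE// /I -!RintegralZl//; try exact: gi.
split; apply: le_Rintegral => //; try exact: iZ.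
  move=> x x01; rewrite [leLHS]mulrA [leRHS]mulrA ler_wpM2r ?g_ge0//.
  by apply: green_chord_l => //; rewrite -in_itv01.
move=> x x01; rewrite [leLHS]mulrA [leRHS]mulrA ler_wpM2r ?g_ge0//.
by apply: green_chord_r => //; rewrite -in_itv01.
Qed.

Variable u : c1w om 0 1.
Hypothesis uc : chord_cone d u.
Let cu : {within `[0, 1], continuous u}. Proof. by have [] := c1wP u. Qed.

(** From [u = c * I <= I] and the bound on [g], [u] is a subsolution, hence nonpositive; in the cone
    it is also nonnegative. *)
Lemma small_source_eq0 (L : c1w om 0 1 -> c1w om 0 1) eps c : 0 < eps ->
  (forall w, L w = integral_op (green d) 0 1 w :> (R -> R)) ->
  0 <= c <= 1 -> (forall t, t \in `[0, 1] -> u t = c * I t) ->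
  (forall s, s \in `[0, 1] -> g s <= Num.max (char_value L - eps) 0 * u s) ->
  sup_norm 0 1 u = 0.
Proof.
move=> eps0 LE /andP[c0 c1] uE gu; set lam := Num.max _ _ in gu.
have l0 : 0 <= lam by rewrite le_max lexx orbT.
have clu : {within `[0, 1], continuous (fun s => lam * u s)}.
  by move=> x; apply: cvgM; [exact: cvg_cst|exact: cu].
have u_le0 t : t \in `[0, 1] -> u t <= 0.
  apply: (@subsolution_char_value_le0 _ d d01 om 0 1 omE _ _ _ L LE u eps) => // t' t01.
  rewrite -green_opZ// integral_opE//.
  apply: (@le_trans _ _ (I t')).
    rewrite uE// ler_piMl//; apply: Rintegral_ge0 => s s01; exact: kg_ge0.
  apply: le_Rintegral => //; [exact: gi|exact: integrable_green|move=> s s01].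
  by apply: ler_wpM2l; [exact: green_ge0|exact: gu].
apply/eqP; rewrite eq_le sup_norm_ge0// andbT.
apply: sup_norm_le => // t t01; rewrite normr_le0 eq_le u_le0//.
by case: uc => h _; apply: h; rewrite -in_itv01.
Qed.

(** The integrand is nonnegative, so restricting the integral to [[a, b]] only decreases it and
    turns [u] into a supersolution for the operator on [[a, b]]. *)
Lemma large_source_absurd (a b eta kap : R) (L : c1w om a b -> c1w om a b) :
  0 < eta -> (forall w, L w = integral_op (green d) a b w :> (R -> R)) ->
  0 <= a -> a < b -> b <= 1 -> 0 < a * (1 - d * b) -> 0 < kap ->
  (forall t, t \in `[a, b] -> kap <= u t) ->
  (forall t, t \in `[0, 1] -> I t <= u t) ->
  (forall s, s \in `[a, b] -> (char_value L + eta) * u s <= g s) -> False.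
Proof.
move=> eta0 LE a0 ab b1 c0 kap0 ku Iu ug.
have sub : [set` `[a, b]] `<=` [set` `[0, 1]].
  by apply: subset_itv; rewrite bnd_simp.
have cab : {within `[a, b], continuous u} by exact: continuous_subspaceW cu.
apply: (@no_char_value_supersolution _ d d01 om a b omE a0 ab b1 L LE u eta kap) => //.
move=> t tab; have t01 : t \in `[0, 1] := sub _ tab.
have clu : {within `[a, b], continuous (fun s => (char_value L + eta) * u s)}.
  by move=> x; apply: cvgM; [exact: cvg_cst|exact: cab].
apply: le_trans (Iu t t01); rewrite -green_opZ// integral_opE//.
have gi' : mu.-integrable `[a, b] (EFin \o (fun s => green d t s * g s)).
  by apply: integrableS (gi t01).
apply: (@le_trans _ _ (\int[mu]_(s in `[a, b]) (green d t s * g s))).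
  apply: le_Rintegral => //; first exact: integrable_green.
  move=> s sab; apply: ler_wpM2l; last exact: ug.
  by apply: green_ge0 => //; rewrite -in_itv01; exact: sub.
apply: fine_le.
- exact: integral_fune_fin_num.
- by apply: integral_fune_fin_num => //; exact: gi.
- apply: ge0_subset_integral => //.
    by have /integrableP[] := gi t01.
  by move=> s s01; rewrite lee_fin; exact: kg_ge0.
Qed.

End NonnegativeSource.

Lemma continuous_dist_le (R : realType) (V : normedModType R) (f : V -> R) :
  (forall v w, `|f v - f w| <= `|v - w|) -> continuous f.
Proof.
move=> fle w; apply: (@cvgrPdist_lt _ _ _ (nbhs w) _ _ _).2 => eps eps0.
have := nbhsx_ballx w eps eps0; apply: filterS => v; rewrite -ball_normE /=.
exact: le_lt_trans.
Qed.

(** * Closedness of the chord cone and continuity of the supremum norm *)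

Section ConeTopology.
Context {R : realType}.
Variables (d : R) (om : R -> R).
Hypothesis d01 : 0 <= d <= 1.

Lemma norm_eval_le (w : c1w om 0 1) t : `|w t| <= `|w|.
Proof.
have [t01|t01] := boolP (t \in `[0, 1]).
  by apply: le_trans (le_sup_norm _ t01) _; rewrite /Num.norm/= le_max lexx.
by have [_ _ _ _ ->] := c1wP w; rewrite // normr0.
Qed.

Lemma eval_continuous t : continuous (fun w : c1w om 0 1 => w t).
Proof.
by apply: continuous_dist_le => v w; exact: (norm_eval_le (v - w)).
Qed.

Lemma closed_chord_cone : closed [set w : c1w om 0 1 | chord_cone d w].
Proof.
move=> z zc.
(* Every condition defining the cone is a linear inequality between values at two points, and
   evaluations are continuous. *)
have lin p q s t : (forall w : c1w om 0 1, chord_cone d w -> 0 <= p * w s + q * w t) ->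
    0 <= p * z s + q * z t.
  move=> h; pose A := [set w : c1w om 0 1 | 0 <= p * w s + q * w t].
  have clA : closed A.
    apply: (@preimage_closed _ _ (fun w : c1w om 0 1 => p * w s + q * w t) [set y | 0 <= y]).
      by move=> w _; exact: (cvgD (cvgM (cvg_cst p) (@eval_continuous s w))
        (cvgM (cvg_cst q) (@eval_continuous t w))).
    exact: closed_ge.
  by apply: clA; exact: (closure_subset h zc).
split=> [t t01|s t s0 st t1].
  have := lin 1 0 t t; rewrite mul1r mul0r addr0; apply=> w [w0 _].
  by rewrite mul1r mul0r addr0 w0.
split; rewrite -subr_ge0.
  rewrite addrC -mulNr; apply: lin => w [_ /(_ s t s0 st t1)[h _]].
  by rewrite mulNr addrC subr_ge0.
rewrite addrC -mulNr; apply: lin => w [_ /(_ s t s0 st t1)[_ h]].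
by rewrite mulNr addrC subr_ge0.
Qed.

Lemma chord_coneD (v w : c1w om 0 1) : chord_cone d v -> chord_cone d w -> chord_cone d (v + w).
Proof.
move=> [v0 vc] [w0 wc]; split=> [t t01|s t s0 st t1].
  by rewrite -[_ t]/(v t + w t) addr_ge0 ?v0 ?w0.
have [v1 v2] := vc s t s0 st t1; have [w1 w2] := wc s t s0 st t1.
by rewrite -[c1w_fun _ t]/(v t + w t) -[c1w_fun _ s]/(v s + w s) !mulrDr !lerD.
Qed.

Lemma chord_coneZ c (w : c1w om 0 1) : 0 <= c -> chord_cone d w -> chord_cone d (c *: w).
Proof.
move=> c0 [w0 wc]; split=> [t t01|s t s0 st t1].
  by rewrite -[_ t]/(c * w t) mulr_ge0 ?w0.
have [w1 w2] := wc s t s0 st t1.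
rewrite -[c1w_fun _ t]/(c * w t) -[c1w_fun _ s]/(c * w s).
by rewrite !(mulrCA _ c) !ler_wpM2l.
Qed.

Lemma sup_normD (v w : c1w om 0 1) : sup_norm 0 1 (v + w) <= sup_norm 0 1 v + sup_norm 0 1 w.
Proof.
apply: sup_norm_le => // t t01; rewrite -[c1w_fun _ t]/(v t + w t).
by apply: le_trans (ler_normD _ _) _; rewrite lerD// le_sup_norm.
Qed.

Lemma sup_normZ c (w : c1w om 0 1) : 0 <= c -> sup_norm 0 1 (c *: w) = c * sup_norm 0 1 w.
Proof.
have h k (v : c1w om 0 1) : 0 <= k -> sup_norm 0 1 (k *: v) <= k * sup_norm 0 1 v.
  move=> k0; apply: sup_norm_le => // t t01; rewrite -[c1w_fun _ t]/(k * v t).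
  by rewrite normrM ger0_norm// ler_wpM2l// le_sup_norm.
move=> c0; apply/eqP; rewrite eq_le h// andTb; have [->|cn0] := eqVneq c 0.
  by rewrite mul0r; exact: (sup_norm_ge0 (0 *: w) ler01).
have cp : 0 < c by rewrite lt_neqAle eq_sym cn0.
rewrite -ler_pdivlMl//; apply: le_trans (h c^-1 _ _); last by rewrite invr_ge0.
by rewrite scalerA mulVf// scale1r.
Qed.

Lemma sup_norm_continuous : continuous (fun w : c1w om 0 1 => sup_norm 0 1 w).
Proof.
have sub (v w : c1w om 0 1) : sup_norm 0 1 v - sup_norm 0 1 w <= `|v - w|.
  rewrite lerBlDr; apply: (@le_trans _ _ (sup_norm 0 1 (v - w) + sup_norm 0 1 w)).
    by rewrite -{1}(subrK w v) sup_normD.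
  by rewrite lerD2r /Num.norm/= le_max lexx.
apply: continuous_dist_le => v w.
by rewrite ler_norml sub lerNl opprB distrC sub.
Qed.

End ConeTopology.

(** * The radial change of variables *)

Section RadialVariable.
Context {R : realType}.
Variables (n : nat) (R0 R1 : R).
Hypotheses (n2 : (2 <= n)%N) (R0_gt0 : 0 < R0) (R01 : R0 < R1).

Let R1_gt0 : 0 < R1. Proof. exact: lt_trans R01. Qed.
Let D := R1 ^+ (n - 2) - R0 ^+ (n - 2).

Let r_of2 t : n = 2%N -> r_of n R0 R1 t = expR ((1 - t) * ln R0 + t * ln R1).
Proof. by move=> ->; rewrite /r_of /= /powR !gt_eqF// expRD. Qed.

Let m_gt0 : n != 2%N -> (0 < n - 2)%N.
Proof. by move=> nn2; rewrite subn_gt0 ltn_neqAle eq_sym nn2. Qed.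

Let D_gt0 : n != 2%N -> 0 < D.
Proof.
move=> /m_gt0 m0; by rewrite subr_gt0 ltr_pXn2r// nnegrE ltW.
Qed.

Let base_gt0 t : n != 2%N -> 0 <= t <= 1 -> 0 < R1 ^+ (n - 2) - D * t.
Proof.
move=> nn2 /andP[t0 t1]; have D0 := D_gt0 nn2.
(* On [[0, 1]] the base decreases from [R1 ^+ (n - 2)] to [R0 ^+ (n - 2)]. *)
have : 0 < R0 ^+ (n - 2) by rewrite exprn_gt0.
have : D * t <= D by rewrite ler_piMr// ltW.
by rewrite /D; lra.
Qed.

Let r_ofn t : n != 2%N ->
  r_of n R0 R1 t = ((R0 * R1) ^+ (n - 2) / (R1 ^+ (n - 2) - D * t)) `^ (n - 2)%:R^-1.
Proof.
move=> nn2; have D0 := D_gt0 nn2.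
rewrite /r_of (negbTE nn2) -/D; congr (_ `^ _).
have -> : R1 ^+ (n - 2) / D - t = (R1 ^+ (n - 2) - D * t) / D.
  by rewrite mulrBl [D * t]mulrC mulfK// gt_eqF.
by rewrite invf_div mulrA divfK// gt_eqF.
Qed.

Lemma r_of_le s t : 0 <= s -> s <= t -> t <= 1 -> r_of n R0 R1 s <= r_of n R0 R1 t.
Proof.
move=> s0 st t1; have [n2'|nn2] := eqVneq n 2%N.
  rewrite !r_of2// ler_expR.
  have : (t - s) * ln R0 <= (t - s) * ln R1.
    by apply: ler_wpM2l; rewrite ?subr_ge0// ler_ln// ltW.
  lra.
have D0 := D_gt0 nn2.
have bs : 0 < R1 ^+ (n - 2) - D * s by apply: base_gt0; rewrite // s0 (le_trans st).
have bt : 0 < R1 ^+ (n - 2) - D * t by apply: base_gt0; rewrite // t1 (le_trans s0).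
have RR : 0 < (R0 * R1) ^+ (n - 2) by rewrite exprn_gt0// mulr_gt0.
rewrite !r_ofn//; apply: ge0_ler_powR;
  rewrite ?invr_ge0// ?nnegrE ?divr_ge0 ?(ltW RR) ?(ltW bs) ?(ltW bt)//.
rewrite ler_pM2l// lef_pV2 ?posrE//.
by apply: lerB => //; rewrite ler_pM2l.
Qed.

Let root_expn (x : R) : n != 2%N -> 0 <= x -> (x ^+ (n - 2)) `^ (n - 2)%:R^-1 = x.
Proof.
move=> nn2 x0; rewrite -powR_mulrn// -powRrM mulfV ?powRr1//.
by rewrite pnatr_eq0 -lt0n m_gt0.
Qed.

Lemma r_of0 : r_of n R0 R1 0 = R0.
Proof.
have [n2'|nn2] := eqVneq n 2%N; first by rewrite r_of2// subr0 mul1r mul0r addr0 lnK.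
rewrite r_ofn// mulr0 subr0 exprMn mulfK ?root_expn ?ltW//.
by rewrite expf_neq0// gt_eqF.
Qed.

Lemma r_of1 : r_of n R0 R1 1 = R1.
Proof.
have [n2'|nn2] := eqVneq n 2%N; first by rewrite r_of2// subrr mul1r mul0r add0r lnK.
rewrite r_ofn// mulr1 /D opprB addrC subrK exprMn mulrAC mulfV ?mul1r ?root_expn ?ltW//.
by rewrite expf_neq0// gt_eqF.
Qed.

Lemma r_of_bounds t : 0 <= t <= 1 -> R0 <= r_of n R0 R1 t <= R1.
Proof.
move=> /andP[t0 t1]; apply/andP; split.
  by rewrite -[leLHS]r_of0; exact: r_of_le.
by rewrite -[leRHS]r_of1; exact: r_of_le.
Qed.

(** Monotonicity provides the bounds that make the [sup] and [inf] of [p_coef] genuine, and the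
    latter positive. *)
Lemma p_coef_le s t : 0 <= s -> s <= t -> t <= 1 -> p_coef n R0 R1 s <= p_coef n R0 R1 t.
Proof.
move=> s0 st t1; rewrite /p_coef; have [n2'|nn2] := eqVneq n 2%N.
  rewrite ler_wpM2r ?sqr_ge0//; apply: lerXn2r; rewrite ?nnegrE; last exact: r_of_le.
    by rewrite r_of2// expR_ge0.
  by rewrite r_of2// expR_ge0.
have bs : 0 < R1 ^+ (n - 2) - D * s by apply: base_gt0; rewrite // s0 (le_trans st).
have bt : 0 < R1 ^+ (n - 2) - D * t by apply: base_gt0; rewrite // t1 (le_trans s0).
rewrite ler_wpM2l ?sqr_ge0// !powRN lef_pV2 ?posrE ?powR_gt0//.
apply: ge0_ler_powR; rewrite ?nnegrE ?(ltW bs) ?(ltW bt) ?divr_ge0 ?mulr_ge0//.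
by apply: lerB => //; rewrite ler_pM2l ?D_gt0.
Qed.

Lemma p_coef_gt0 t : 0 <= t <= 1 -> 0 < p_coef n R0 R1 t.
Proof.
move=> t01; rewrite /p_coef; have [n2'|nn2] := eqVneq n 2%N.
  rewrite r_of2// mulr_gt0 ?exprn_gt0 ?expR_gt0// ln_gt0//.
  by rewrite ltr_pdivlMr// mul1r.
rewrite mulr_gt0 ?powR_gt0//; last exact: base_gt0.
by rewrite exprn_gt0// divr_gt0 ?ltr0n ?m_gt0// mulr_gt0 ?mulr_gt0 ?D_gt0.
Qed.

Lemma p_coef_sup t : 0 <= t <= 1 -> p_coef n R0 R1 t <= sup (p_coef n R0 R1 @` `[0, 1]).
Proof.
move=> t01; apply: ub_le_sup; last by exists t => //=; rewrite in_itv.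
exists (p_coef n R0 R1 1) => _ [s /= + <-]; rewrite in_itv/= => /andP[s0 s1].
exact: p_coef_le.
Qed.

Lemma p_coef_inf a b t : 0 <= a -> b <= 1 -> a <= t <= b ->
  0 < inf (p_coef n R0 R1 @` `[a, b]) <= p_coef n R0 R1 t.
Proof.
move=> a0 b1 /andP[at_ tb].
have lb s : s \in `[a, b] -> p_coef n R0 R1 a <= p_coef n R0 R1 s.
  by rewrite in_itv/= => /andP[as_ sb]; apply: p_coef_le => //; exact: le_trans b1.
have pa : 0 < p_coef n R0 R1 a.
  by apply: p_coef_gt0; rewrite a0 (le_trans at_)// (le_trans tb).
have tab : (`[a, b]%classic : set R) t by rewrite /= in_itv/= at_.
apply/andP; split.
  apply: lt_le_trans pa _; apply: lb_le_inf; first by exists (p_coef n R0 R1 t), t.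
  by move=> _ [s sab <-]; exact: lb.
apply: ge_inf; last by exists t.
by exists (p_coef n R0 R1 a) => _ [s sab <-]; exact: lb.
Qed.

End RadialVariable.

(** * The elliptic system *)

Section MainLemmas.
Context {R : realType}.

Lemma k1E : @k1 R = green 1.
Proof.
apply/funext => t; apply/funext => s; rewrite /k1 /green.
by case: (leP s t) => _; rewrite mul1r.
Qed.

Lemma k2E : @k2 R = green 0.
Proof.
by apply/funext => t; apply/funext => s; rewrite /k2 /green mul0r subr0 mulr1.
Qed.

Lemma omega1E (t : R) : omega1 t = t * (1 - 1 * t).
Proof. by rewrite mul1r. Qed.

Lemma omega2E (t : R) : omega2 t = t * (1 - 0 * t).
Proof. by rewrite mul0r subr0 mulr1. Qed.

Definition chord_pair : set (c1w_pair R) :=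
  [set x : c1w_pair R | chord_cone 1 x.1 /\ chord_cone 0 x.2].

Lemma closed_chord_pair : closed chord_pair.
Proof.
apply: closedI.
  apply: (@preimage_closed _ _ (fun x : c1w_pair R => x.1) [set w | chord_cone 1 w]).
    by move=> x _; exact: cvg_fst.
  exact: closed_chord_cone.
apply: (@preimage_closed _ _ (fun x : c1w_pair R => x.2) [set w | chord_cone 0 w]).
  by move=> x _; exact: cvg_snd.
exact: closed_chord_cone.
Qed.

Definition box_norm (theta1 theta2 : R) (x : c1w_pair R) :=
  Num.max (sup_norm 0 1 x.1 / theta1) (sup_norm 0 1 x.2 / theta2).

Lemma box_norm_continuous theta1 theta2 : continuous (box_norm theta1 theta2).
Proof.
have c1 : continuous (fun x : c1w_pair R => sup_norm 0 1 x.1 / theta1).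
  move=> x; have h := @continuous_comp (c1w_pair R) _ _ fst
    (fun w : c1w omega1 0 1 => sup_norm 0 1 w) x cvg_fst (@sup_norm_continuous _ _ x.1).
  exact: (cvgM (h _) (cvg_cst theta1^-1)).
have c2 : continuous (fun x : c1w_pair R => sup_norm 0 1 x.2 / theta2).
  move=> x; have h := @continuous_comp (c1w_pair R) _ _ snd
    (fun w : c1w omega2 0 1 => sup_norm 0 1 w) x cvg_snd (@sup_norm_continuous _ _ x.2).
  exact: (cvgM (h _) (cvg_cst theta2^-1)).
by move=> x; have := continuous_max (c1 x) (c2 x).
Qed.

Variables (n : nat) (R0 R1 : R).
Hypotheses (n2 : (2 <= n)%N) (R0_gt0 : 0 < R0) (R01 : R0 < R1).
Variable f : R * R * R * R * R -> R.
Notation tf := (transformed n R0 R1 f).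

Let z_of (s z : R) := z / `|derive1 (r_of n R0 R1) s|.

Lemma transformed_ge0 s w1 w2 z1 z2 : (forall x, f_domain R0 R1 x -> 0 <= f x) ->
  0 <= s <= 1 -> 0 <= w1 -> 0 <= w2 -> 0 <= z1 -> 0 <= z2 -> 0 <= tf s w1 w2 z1 z2.
Proof.
move=> f0 s01 w10 w20 z10 z20; rewrite /transformed mulr_ge0//.
  by apply/ltW/p_coef_gt0.
by apply: f0; split; rewrite ?divr_ge0//; exact: r_of_bounds.
Qed.

(** The factor [p_coef] cancels against its supremum only for a nonnegative constant, hence the
    passage from [c] to [Num.max c 0]. *)
Lemma transformed_le s w1 w2 z1 z2 c w : 0 <= s <= 1 -> 0 <= w ->
  f (r_of n R0 R1 s, w1, w2, z_of s z1, z_of s z2) <=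
    c / sup (p_coef n R0 R1 @` `[0, 1]) * w ->
  tf s w1 w2 z1 z2 <= Num.max c 0 * w.
Proof.
move=> s01 w0 fle; have p0 := p_coef_gt0 n2 R0_gt0 R01 s01.
have ps := p_coef_sup n2 R0_gt0 R01 s01; set S := sup _ in fle ps.
have S0 : 0 < S by exact: lt_le_trans ps.
have m0 : 0 <= Num.max c 0 by rewrite le_max lexx orbT.
apply: (@le_trans _ _ (p_coef n R0 R1 s * (Num.max c 0 / S * w))).
  rewrite /transformed ler_pM2l//; apply: le_trans fle _.
  by rewrite ler_wpM2r// ler_pM2r ?invr_gt0// le_max lexx.
rewrite mulrA ler_wpM2r// mulrCA -[leRHS]mulr1 ler_wpM2l//.
by rewrite ler_pdivrMr// mul1r.
Qed.

Lemma transformed_ge s w1 w2 z1 z2 a b c w : 0 <= a -> b <= 1 -> a <= s <= b ->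
  0 <= c -> 0 <= w ->
  c / inf (p_coef n R0 R1 @` `[a, b]) * w <=
    f (r_of n R0 R1 s, w1, w2, z_of s z1, z_of s z2) ->
  c * w <= tf s w1 w2 z1 z2.
Proof.
move=> a0 b1 sab c0 w0 fge.
have /andP[I0 Ip] := p_coef_inf n2 R0_gt0 R01 a0 b1 sab; set S := inf _ in fge I0 Ip.
have p0 : 0 < p_coef n R0 R1 s by exact: lt_le_trans Ip.
apply: (@le_trans _ _ (p_coef n R0 R1 s * (c / S * w))); last first.
  by rewrite /transformed ler_pM2l.
rewrite mulrA ler_wpM2r// mulrCA -[leLHS]mulr1 ler_wpM2l//.
by rewrite ler_pdivlMr// mul1r.
Qed.

Lemma between_r_of a b s : 0 <= a -> b <= 1 -> a <= s <= b ->
  between_r n R0 R1 a b (r_of n R0 R1 s).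
Proof.
move=> a0 b1 /andP[as_ sb]; rewrite /between_r ge_min le_max.
rewrite (r_of_le n2 R0_gt0 R01 a0 as_ (le_trans sb b1)).
by rewrite (r_of_le n2 R0_gt0 R01 (le_trans a0 as_) sb b1) orbT.
Qed.

End MainLemmas.

Unset Implicit Arguments.

Theorem theorem5p7 (R : realType) (n : nat) (R0 R1 : R)
  (f1 f2 : R * R * R * R * R -> R) (a1 b1 a2 b2 : R)
  (eps1 eps2 eta1 eta2 rho1 rho2 theta1 theta2 : R)
  (n_ge2 : (2 <= n)%N) (R0_gt0 : 0 < R0) (R0_lt_R1 : R0 < R1)
  (f1_cont : {within f_domain R0 R1, continuous f1})
  (f2_cont : {within f_domain R0 R1, continuous f2})
  (f1_ge0 : forall x, f_domain R0 R1 x -> 0 <= f1 x)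
  (f2_ge0 : forall x, f_domain R0 R1 x -> 0 <= f2 x)
  (a1_gt0 : 0 < a1) (a1_lt_b1 : a1 < b1) (b1_lt1 : b1 < 1)
  (a2_gt0 : 0 < a2) (a2_lt_b2 : a2 < b2) (b2_le1 : b2 <= 1)
  (T_def : T_defined n R0 R1 f1 f2 (cone a1 b1 a2 b2))
  (T_compact : compact_self_map (cone a1 b1 a2 b2) (T_op n R0 R1 f1 f2))
  (eps1_gt0 : 0 < eps1) (eps2_gt0 : 0 < eps2)
  (eta1_gt0 : 0 < eta1) (eta2_gt0 : 0 < eta2)
  (rho1_gt0 : 0 < rho1) (rho2_gt0 : 0 < rho2)
  (theta1_gt0 : 0 < theta1) (theta2_gt0 : 0 < theta2)
  (rho1_le : rho1 <= cst1 a1 b1 * theta1)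
  (rho2_le : rho2 <= cst2 a2 * theta2)
  (f1_le : forall r w1 w2 z1 z2,
    Omega_region R0 R1 rho1 rho2 (r, w1, w2, z1, z2) ->
    f1 (r, w1, w2, z1, z2) <=
      (char_value (L1 0 1) - eps1) /
        sup (p_coef n R0 R1 @` `[0, 1]) * w1)
  (f2_le : forall r w1 w2 z1 z2,
    Omega_region R0 R1 rho1 rho2 (r, w1, w2, z1, z2) ->
    f2 (r, w1, w2, z1, z2) <=
      (char_value (L2 0 1) - eps2) /
        sup (p_coef n R0 R1 @` `[0, 1]) * w2)
  (f1_ge : forall r w1 w2 z1 z2,
    D1_region n R0 R1 a1 b1 theta1 (r, w1, w2, z1, z2) ->
    f1 (r, w1, w2, z1, z2) >=
      (char_value (L1 a1 b1) + eta1) /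
        inf (p_coef n R0 R1 @` `[a1, b1]) * w1)
  (f2_ge : forall r w1 w2 z1 z2,
    D2_region n R0 R1 a2 b2 theta2 (r, w1, w2, z1, z2) ->
    f2 (r, w1, w2, z1, z2) >=
      (char_value (L2 a2 b2) + eta2) /
        inf (p_coef n R0 R1 @` `[a2, b2]) * w2) :
  exists x : c1w_pair R,
    [/\ cone a1 b1 a2 b2 x, 0 < `|x| & x = T_op n R0 R1 f1 f2 x].
Proof.
have one01 : 0 <= (1 : R) <= 1 by rewrite ler01 lexx.
have zero01 : 0 <= (0 : R) <= 1 by rewrite ler01 lexx.
set T := T_op n R0 R1 f1 f2 in T_compact *.
set K := cone a1 b1 a2 b2 in T_def T_compact *.
have a1_lt1 : a1 < 1 by exact: lt_trans b1_lt1.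
have a2_lt1 : a2 < 1 by exact: lt_le_trans b2_le1.
have cst1_gt0 : 0 < cst1 a1 b1 by rewrite lt_min a1_gt0 subr_gt0.
have cst1_le1 : cst1 a1 b1 <= 1 by rewrite ge_min ltW.
have rho1t : rho1 <= theta1 by apply: le_trans rho1_le _; rewrite ler_piMl// ltW.
have rho2t : rho2 <= theta2.
  by apply: le_trans rho2_le _; rewrite ler_piMl// ltW.
have K'K : chord_pair `<=` K.
  move=> x [x1 x2]; split.
    apply: (chord_cone_component one01 omega1E x1
      (ltW a1_gt0) (ltW a1_lt_b1) (ltW b1_lt1)) => //.
      by rewrite ge_min lexx.
    by rewrite ge_min mul1r lexx orbT.
  apply: (chord_cone_component zero01 omega2E x2 (ltW a2_gt0) (ltW a2_lt_b2)) => //.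
  by rewrite mul0r subr0; exact: ltW.
pose g1 (x : c1w_pair R) s :=
  transformed n R0 R1 f1 s (x.1 s) (x.2 s) `|derive1 x.1 s| `|derive1 x.2 s|.
pose g2 (x : c1w_pair R) s :=
  transformed n R0 R1 f2 s (x.1 s) (x.2 s) `|derive1 x.1 s| `|derive1 x.2 s|.
have pos1 (x : c1w_pair R) s : chord_pair x -> s \in `[0, 1] -> 0 <= x.1 s.
  by move=> [[h _] _]; rewrite in_itv01; exact: h.
have pos2 (x : c1w_pair R) s : chord_pair x -> s \in `[0, 1] -> 0 <= x.2 s.
  by move=> [_ [h _]]; rewrite in_itv01; exact: h.
have g1_ge0 x s : chord_pair x -> s \in `[0, 1] -> 0 <= g1 x s.
  move=> Kx s01; apply: transformed_ge0; rewrite // -?in_itv01//; [exact: pos1|exact: pos2].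
have g2_ge0 x s : chord_pair x -> s \in `[0, 1] -> 0 <= g2 x s.
  move=> Kx s01; apply: transformed_ge0; rewrite // -?in_itv01//; [exact: pos1|exact: pos2].
have g1i x t : chord_pair x -> t \in `[0, 1] ->
    lebesgue_measure.-integrable `[0, 1] (EFin \o (fun s => green 1 t s * g1 x s)).
  by move=> /K'K /T_def[h _ _ _] t01; have := h t t01; rewrite /integrand k1E.
have g2i x t : chord_pair x -> t \in `[0, 1] ->
    lebesgue_measure.-integrable `[0, 1] (EFin \o (fun s => green 0 t s * g2 x s)).
  by move=> /K'K /T_def[_ h _ _] t01; have := h t t01; rewrite /integrand k2E.
have T1E x t : chord_pair x -> t \in `[0, 1] ->
    (T x).1 t = \int[lebesgue_measure]_(s in `[0, 1]) (green 1 t s * g1 x s).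
  move=> /K'K /T_def[_ _ h _] t01; rewrite /T /T_op /= -[c1w_fun _]/(val _) insubdK//.
  by rewrite /T_fun patchE ifT ?mem_setE// /integrand k1E.
have T2E x t : chord_pair x -> t \in `[0, 1] ->
    (T x).2 t = \int[lebesgue_measure]_(s in `[0, 1]) (green 0 t s * g2 x s).
  move=> /K'K /T_def[_ _ _ h] t01; rewrite /T /T_op /= -[c1w_fun _]/(val _) insubdK//.
  by rewrite /T_fun patchE ifT ?mem_setE// /integrand k2E.
have TK' x : chord_pair x -> chord_pair (T x).
  move=> Kx; split.
    by apply: (@green_source_chord_cone _ _ (g1 x)) => // [s|t|t];
      [exact: g1_ge0|exact: g1i|exact: T1E].
  by apply: (@green_source_chord_cone _ _ (g2 x)) => // [s|t|t];
    [exact: g2_ge0|exact: g2i|exact: T2E].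
clearbody T; pose N := box_norm theta1 theta2.
have N1 x c : N x <= c -> sup_norm 0 1 x.1 <= c * theta1.
  by rewrite ge_max => /andP[h _]; rewrite -ler_pdivrMr.
have N2 x c : N x <= c -> sup_norm 0 1 x.2 <= c * theta2.
  by rewrite ge_max => /andP[_ h]; rewrite -ler_pdivrMr.
have Nc : continuous N := @box_norm_continuous _ theta1 theta2.
have N0 x : 0 <= N x.
  by rewrite le_max divr_ge0 ?(ltW theta1_gt0)// sup_norm_ge0.
have ND x y : N (x + y) <= N x + N y.
  rewrite ge_max; apply/andP; split.
    apply: (@le_trans _ _ (sup_norm 0 1 x.1 / theta1 + sup_norm 0 1 y.1 / theta1)).
      by rewrite -mulrDl ler_pM2r ?invr_gt0// sup_normD.
    by apply: lerD; rewrite le_max lexx.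
  apply: (@le_trans _ _ (sup_norm 0 1 x.2 / theta2 + sup_norm 0 1 y.2 / theta2)).
    by rewrite -mulrDl ler_pM2r ?invr_gt0// sup_normD.
  by apply: lerD; rewrite le_max lexx orbT.
have NZ a x : 0 <= a -> N (a *: x) = a * N x.
  by move=> a0; rewrite /N maxr_pMr// !mulrA -!sup_normZ.
have [TKK Tcont Tprec] := T_compact.
pose B := [set x | chord_pair x /\ N x <= 2].
(* [N] sees only supremum norms, but on [K] these dominate the derivative norms, so [B] is bounded
   in the full norm. *)
have cM : compact (closure (T @` B)).
  rewrite -precompactE; apply: Tprec; first by move=> x [/K'K].
  exists (2 * (theta1 + theta2)); split; first exact: num_real.
  move=> M hM x [Kx Nx]; apply: le_trans (ltW hM).
  have [[_ _ d1] [_ _ d2]] := K'K x Kx.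
  have s1 : sup_norm 0 1 x.1 <= 2 * (theta1 + theta2).
    by apply: le_trans (N1 x 2 Nx) _; rewrite ler_pM2l// lerDl ltW.
  have s2 : sup_norm 0 1 x.2 <= 2 * (theta1 + theta2).
    by apply: le_trans (N2 x 2 Nx) _; rewrite ler_pM2l// lerDr ltW.
  by rewrite prod_normE /Num.norm/= !ge_max s1 s2 (le_trans d1 s1) (le_trans d2 s2).
have Tc x : chord_pair x -> T @ within chord_pair (nbhs x) --> T x.
  move=> Kx; apply: (cvg_within_subset K'K).
  by move/subspace_continuousP : Tcont; apply; exact: K'K.
pose o := one omega2 (0 : R) 1.
have oE t : t \in `[0, 1] -> o t = 1 by exact: oneE.
(* The factor [theta2] gives [N e = 1]; evaluating the second component at 1 then yields [Ne_le]. *)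
pose e : c1w_pair R := (0, theta2 *: o).
have so : sup_norm 0 1 o = 1.
  apply/eqP; rewrite eq_le; apply/andP; split.
    by apply: sup_norm_le => // t t01; rewrite oE// normr1.
  have h : (1 : R) \in `[0, 1] by rewrite in_itv/= ler01 lexx.
  by have := le_sup_norm o h; rewrite oE// normr1.
have Ke : chord_pair e.
  split; last first.
    apply: chord_coneZ; [exact: ltW|split=> [t t01|s t s0 st t1]].
      by rewrite oE ?in_itv.
    rewrite !oE ?in_itv/= ?s0 ?t1 ?(le_trans st)// ?(le_trans s0)//.
    by rewrite !mul0r !mulr1.
  by split=> [t _|s t _ _ _]; rewrite -[c1w_fun _]/(fun=> 0 : R)// !mulr0.
have Ne : N e = 1.
  have e1 : sup_norm 0 1 e.1 = 0.
    have := @sup_normZ R omega1 0 0 (lexx 0); rewrite mul0r scale0r; exact.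
  have e2 : sup_norm 0 1 e.2 = theta2 by rewrite (sup_normZ o (ltW theta2_gt0)) so mulr1.
  by rewrite /N /box_norm e1 e2 mul0r divff ?gt_eqF// max_r.
have Ne_le x b : chord_pair x -> 0 <= b -> b <= N (x + b *: e).
  move=> Kx b0; rewrite le_max; apply/orP; right; rewrite ler_pdivlMr//.
  have h : (1 : R) \in `[0, 1] by rewrite in_itv/= ler01 lexx.
  apply: le_trans (le_sup_norm _ h); apply: le_trans (ler_norm _).
  rewrite -[leRHS]/(x.2 1 + b * (theta2 * o 1)) oE// mulr1 lerDr.
  exact: pos2.
(* With this choice [N x <= 2 * rho] bounds the components by [rho1] and [rho2], which is where the
   upper estimates on [f1] and [f2] apply. *)
pose rho := Num.min (rho1 / theta1) (rho2 / theta2) / 2.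
have rho_gt0 : 0 < rho by rewrite divr_gt0// lt_min !divr_gt0.
have rho2E : 2 * rho = Num.min (rho1 / theta1) (rho2 / theta2) by rewrite mulrC divfK.
have rho_le1 : 2 * rho <= 1.
  by rewrite rho2E ge_min ler_pdivrMr// mul1r rho1t.
have K'Z c (x : c1w_pair R) : 0 <= c -> chord_pair x -> chord_pair (c *: x).
  by move=> c0 [x1 x2]; split; exact: chord_coneZ.
have K'D (x y : c1w_pair R) : chord_pair x -> chord_pair y -> chord_pair (x + y).
  by move=> [x1 x2] [y1 y2]; split; exact: chord_coneD.
have small (x : c1w_pair R) s : chord_pair x -> 0 < N x <= 2 * rho ->
    0 <= s <= 1 -> x <> s *: T x.
  move=> Kx /andP[Nx0 Nx] s01 xE.
  have b1' t : t \in `[0, 1] -> 0 <= x.1 t <= rho1.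
    move=> t01; rewrite pos1//=; apply: le_trans (ler_norm _) _.
    apply: le_trans (le_sup_norm _ t01) _; apply: le_trans (N1 _ _ Nx) _.
    by rewrite -ler_pdivlMr// rho2E ge_min lexx.
  have b2' t : t \in `[0, 1] -> 0 <= x.2 t <= rho2.
    move=> t01; rewrite pos2//=; apply: le_trans (ler_norm _) _.
    apply: le_trans (le_sup_norm _ t01) _; apply: le_trans (N2 _ _ Nx) _.
    by rewrite -ler_pdivlMr// rho2E ge_min lexx orbT.
  have reg t : t \in `[0, 1] -> Omega_region R0 R1 rho1 rho2
      (r_of n R0 R1 t, x.1 t, x.2 t, `|derive1 x.1 t| / `|derive1 (r_of n R0 R1) t|,
        `|derive1 x.2 t| / `|derive1 (r_of n R0 R1) t|).
    move=> t01; split; rewrite ?divr_ge0//; [|exact: b1'|exact: b2'].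
    by apply: r_of_bounds; rewrite // -in_itv01.
  have u0 : sup_norm 0 1 x.1 = 0.
    apply: (@small_source_eq0 _ 1 omega1 (g1 x) one01 omega1E _ _ x.1
      Kx.1 (L1 0 1) eps1 s) => //.
    - by move=> t; exact: g1_ge0.
    - by move=> t; exact: g1i.
    - by move=> w; rewrite /= k1E.
    - by move=> t t01; rewrite -T1E//; exact: (congr1 (fun y : c1w_pair R => y.1 t) xE).
    - move=> t t01; apply: transformed_le; rewrite // -?in_itv01//; first exact: pos1.
      by apply: f1_le; exact: reg.
  have v0 : sup_norm 0 1 x.2 = 0.
    apply: (@small_source_eq0 _ 0 omega2 (g2 x) zero01 omega2E _ _ x.2
      Kx.2 (L2 0 1) eps2 s) => //.
    - by move=> t; exact: g2_ge0.
    - by move=> t; exact: g2i.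
    - by move=> w; rewrite /= k2E.
    - by move=> t t01; rewrite -T2E//; exact: (congr1 (fun y : c1w_pair R => y.2 t) xE).
    - move=> t t01; apply: transformed_le; rewrite // -?in_itv01//; first exact: pos2.
      by apply: f2_le; exact: reg.
  by move: Nx0; rewrite /N /box_norm u0 v0 !mul0r maxxx ltxx.
have large (x : c1w_pair R) m : chord_pair x -> 1 <= N x -> 0 <= m -> x <> T x + m *: e.
  (* One component reaches its [theta], hence stays above [cst1 a1 b1 * theta1] or
     [cst2 a2 * theta2] on its subinterval, and that component alone gives the contradiction. The
     term [m *: e] is 0 in the first component and nonnegative in the second. *)
  move=> Kx Nx m0 xE; move: Nx; rewrite le_max !ler_pdivlMr// !mul1r => /orP[hx|hx].
    have ge t : t \in `[a1, b1] -> cst1 a1 b1 * theta1 <= x.1 t.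
      rewrite in_itv/= => tab; apply: le_trans (_ : cst1 a1 b1 * sup_norm 0 1 x.1 <= _).
        by rewrite ler_pM2l.
      apply: (chord_cone_ge one01 Kx.1 (ltW a1_gt0) (ltW b1_lt1)) tab => //.
        by rewrite ge_min lexx.
      by rewrite ge_min mul1r lexx orbT.
    have c0 : 0 < a1 * (1 - 1 * b1) by rewrite mulr_gt0// mul1r subr_gt0.
    have L1E (w : c1w omega1 a1 b1) : L1 a1 b1 w = integral_op (green 1) a1 b1 w :> (R -> R).
      by rewrite /= k1E.
    apply: (@large_source_absurd _ 1 omega1 (g1 x) one01 omega1E _ _ x.1 a1 b1 eta1
      (cst1 a1 b1 * theta1) (L1 a1 b1)) => //.
    - by move=> t; exact: g1_ge0.
    - by move=> t; exact: g1i.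
    - exact: ltW.
    - exact: ltW.
    - exact: mulr_gt0.
    - by move=> t t01; rewrite -T1E// [in leRHS]xE -[leRHS]/((T x).1 t + m * 0) mulr0 addr0.
    - move=> s sab; have s01 : s \in `[0, 1].
        by move: sab; rewrite !in_itv/= => /andP[h1 h2];
          rewrite (le_trans (ltW a1_gt0))// (le_trans h2)// ltW.
      have xs0 := pos1 x s Kx s01; have ys0 := pos2 x s Kx s01.
      have sab' : a1 <= s <= b1 by move: sab; rewrite in_itv.
      apply: (@transformed_ge _ _ _ _ n_ge2 R0_gt0 R0_lt_R1 f1 s _ _ _ _ a1 b1)
        => //; [exact: ltW|exact: ltW| |].
        rewrite addr_ge0 ?(ltW eta1_gt0)//.
        exact: (char_value_ge0 one01 omega1E (ltW a1_gt0) a1_lt_b1 (ltW b1_lt1) L1E).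
      apply: f1_ge; split; rewrite ?divr_ge0//; last exact: ge.
      exact: (between_r_of n_ge2 R0_gt0 R0_lt_R1 (ltW a1_gt0) (ltW b1_lt1) sab').
  have ge t : t \in `[a2, b2] -> cst2 a2 * theta2 <= x.2 t.
    rewrite in_itv/= => tab; apply: le_trans (_ : cst2 a2 * sup_norm 0 1 x.2 <= _).
      by rewrite ler_pM2l.
    apply: (chord_cone_ge zero01 Kx.2 (ltW a2_gt0) b2_le1) tab => //.
    by rewrite mul0r subr0; exact: ltW.
  have c0 : 0 < a2 * (1 - 0 * b2) by rewrite mul0r subr0 mulr1.
  have L2E (w : c1w omega2 a2 b2) : L2 a2 b2 w = integral_op (green 0) a2 b2 w :> (R -> R).
    by rewrite /= k2E.
  apply: (@large_source_absurd _ 0 omega2 (g2 x) zero01 omega2E _ _ x.2 a2 b2 eta2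
    (cst2 a2 * theta2) (L2 a2 b2)) => //.
  - by move=> t; exact: g2_ge0.
  - by move=> t; exact: g2i.
  - exact: ltW.
  - exact: mulr_gt0.
  - move=> t t01; rewrite -T2E// [in leRHS]xE.
    rewrite -[leRHS]/((T x).2 t + m * (theta2 * o t)) oE// mulr1 lerDl.
    by rewrite mulr_ge0// ltW.
  - move=> s sab; have s01 : s \in `[0, 1].
      by move: sab; rewrite !in_itv/= => /andP[h1 h2];
        rewrite (le_trans (ltW a2_gt0))// (le_trans h2).
    have xs0 := pos1 x s Kx s01; have ys0 := pos2 x s Kx s01.
    have sab' : a2 <= s <= b2 by move: sab; rewrite in_itv.
    apply: (@transformed_ge _ _ _ _ n_ge2 R0_gt0 R0_lt_R1 f2 s _ _ _ _ a2 b2)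
      => //; [exact: ltW| |].
      rewrite addr_ge0 ?(ltW eta2_gt0)//.
      exact: (char_value_ge0 zero01 omega2E (ltW a2_gt0) a2_lt_b2 b2_le1 L2E).
    apply: f2_ge; split; rewrite ?divr_ge0//; last exact: ge.
    exact: (between_r_of n_ge2 R0_gt0 R0_lt_R1 (ltW a2_gt0) b2_le1 sab').
have [x [Kx Nx Tx]] := @cone_expansion_fixed_point R (c1w_pair R) chord_pair
  (closure (T @` B)) N T e rho closed_chord_pair K'D K'Z Nc N0 ND NZ TK' cM Tc
  (fun x Kx Nx => subset_closure (ex_intro2 _ _ x (conj Kx Nx) erefl))
  Ke Ne Ne_le rho_gt0 rho_le1 small large.
exists x; split => //; first exact: K'K.
rewrite normr_gt0; apply: contraTneq Nx => ->.
by rewrite -(scale0r (0 : c1w_pair R)) NZ// mul0r ltxx.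
Qed.
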